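(* Let $\mathcal H$ be a separable infinite-dimensional complex Hilbert space and let $P_0\in\mathcal P_\infty(\mathcal H)$. \begin{enumerate} \item The action $U\cdot Q=UQU^*$ of $\mathcal U_{res}^0(P_0)$ on $\mathcal C_\infty(P_0)$ is transitive. In particular, $\mathcal C_\infty(P_0)$ is connected. \item $\mathcal C_\infty$ is connected. \end{enumerate}
   Context: $\mathcal P(\mathcal H)$ is the set of orthogonal projections of $\mathcal H$, and $\mathcal P_\infty(\mathcal H)$ is the set of those with infinite-dimensional range and infinite-dimensional nullspace. $\pi:\mathcal B(\mathcal H)\to\mathcal B(\mathcal H)/\mathcal K(\mathcal H)$ is the quotient map onto the Calkin algebra. For $P\in\mathcal P_\infty(\mathcal H)$, $\mathcal C_\infty(P)$ is the set of $Q\in\mathcal P(\mathcal H)$ such that $PQ$ is compact and $\pi((1-P)(1-Q)(1-P))\neq \pi(1-P),0$ (i.e. the compression of $Q$ to $N(P)$ is a projection different from $0$ and $1$ in the Calkin algebra of $N(P)$). $\mathcal C_\infty=\{(P,Q): P\in\mathcal P_\infty(\mathcal H),\ Q\in\mathcal C_\infty(P)\}$. All these sets carry the operator norm topology. $\mathcal U_{res}(P_0)=\{U \text{ unitary in }\mathcal H: UP_0-P_0U\text{ is compact}\}$; for such $U$ the compression $u_{11}=P_0U|_{R(P_0)}:R(P_0)\to R(P_0)$ is Fredholm, and its Fredholm index is called the index of $U$. $\mathcal U_{res}^0(P_0)$ is the connected component of the identity in $\mathcal U_{res}(P_0)$ (norm topology), equivalently the set of elements of index $0$. *)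

(* Defs.v *)
From HB Require Import structures.
From mathcomp Require Import all_boot all_order all_algebra.
From mathcomp Require Import all_classical all_reals all_analysis.
From mathcomp Require Import complex.
From mathcomp Require Import generic_quotient ring_quotient.

Set Implicit Arguments.
Unset Strict Implicit.
Unset Printing Implicit Defensive.

Import Order.TTheory GRing.Theory Num.Theory.
Import numFieldNormedType.Exports.

Local Open Scope classical_set_scope.
Local Open Scope ring_scope.
Local Open Scope complex_scope.
Local Open Scope quotient_scope.

(* Complex Hilbert spaces. The inner product is linear in its first argument
   and conjugate-linear in the second one. *)
HB.mixin Record CompleteNormedModule_isHilbert (R : realType) H
    & CompleteNormedModule R[i] H := {
  inner : {dot H for (@Num.conj R[i])};
  inner_norm : forall x : H, inner x x = `|x| ^+ 2
}.

#[short(type="hilbertType")]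
HB.structure Definition Hilbert (R : realType) :=
  {H of CompleteNormedModule R[i] H & CompleteNormedModule_isHilbert R H}.

Definition separable (T : topologicalType) : Prop :=
  exists2 D : set T, countable D & dense D.

(* For a linear subspace A this says that A has finite dimension. *)
Definition finite_dim (K : pzRingType) (V : lmodType K) (A : set V) : Prop :=
  exists (n : nat) (e : 'I_n -> V),
    forall x, A x -> exists c : 'I_n -> K, x = \sum_(i < n) c i *: e i.

Definition infinite_dim (K : pzRingType) (V : lmodType K) (A : set V) : Prop :=
  ~ finite_dim A.

Section BoundedOperators.
Variables (R : realType) (H : hilbertType R).

Definition bounded_linear : {pred H -> H} := fun f =>
  `[< linear f /\ exists M : R, forall x, `|f x| <= M%:C * `|x| >].

Lemma bounded_linearP (f : H -> H) :
  reflect (linear f /\ exists M : R, forall x, `|f x| <= M%:C * `|x|)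
          (f \in bounded_linear).
Proof. exact: asboolP. Qed.

Lemma complex_normE (V : normedZmodType R[i]) (x : V) :
  `|x| = (complex.Re `|x|)%:C.
Proof.
have := normr_ge0 x; rewrite lecE => /andP[/eqP i0 _]; apply/eqP.
by rewrite eq_complex /= i0 !eqxx.
Qed.

Lemma bounded_linear_submod : GRing.submod_closed bounded_linear.
Proof.
split.
  apply/bounded_linearP; split; first by move=> a x y; rewrite /= scaler0 addr0.
  by exists 0 => x; rewrite normr0 mul0r.
move=> c f g /bounded_linearP[lf [M fM]] /bounded_linearP[lg [N gN]].
apply/bounded_linearP; split.
  move=> a x y; rewrite !fctE lf lg !scalerDr !scalerA [c * a]mulrC.
  by rewrite -!scalerA addrACA.
have [m cm] : exists m : R, `|c| = m%:C.
  by exists (complex.Re `|c|); exact: complex_normE.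
exists (m * M + N) => x; rewrite !fctE rmorphD mulrDl.
apply: le_trans (ler_normD _ _) _; apply: lerD => //.
by rewrite normrZ cm rmorphM /= -mulrA ler_wpM2l // -cm.
Qed.

HB.instance Definition _ :=
  GRing.isSubmodClosed.Build R[i] (H -> H) bounded_linear bounded_linear_submod.

Record bop := Bop {
  bop_fun :> H -> H;
  bop_subproof : bop_fun \in bounded_linear
}.

HB.instance Definition _ := [isSub for bop_fun].
HB.instance Definition _ := [Choice of bop by <:].
HB.instance Definition _ := [SubChoice_isSubLmodule of bop by <:].

Implicit Types S T : bop.

Lemma bopP T : linear T /\ exists M : R, forall x, `|T x| <= M%:C * `|x|.
Proof. by apply/bounded_linearP; case: T. Qed.

Lemma bop_linear T : linear T. Proof. by case: (bopP T). Qed.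

HB.instance Definition _ T :=
  GRing.isLinear.Build R[i] H H *:%R T (bop_linear T).

Lemma bop_eqP S T : S =1 T -> S = T.
Proof. by move=> ST; apply: val_inj; exact/funext. Qed.

Lemma bop0E x : (0 : bop) x = 0. Proof. by []. Qed.
Lemma bopDE S T x : (S + T) x = S x + T x. Proof. by []. Qed.
Lemma bopNE T x : (- T) x = - T x. Proof. by []. Qed.
Lemma bopZE (c : R[i]) T x : (c *: T) x = c *: T x. Proof. by []. Qed.

Lemma bop_one_subproof : (id : H -> H) \in bounded_linear.
Proof.
by apply/bounded_linearP; split=> //; exists 1 => x; rewrite mul1r.
Qed.

Lemma bop_mul_subproof S T : (fun x => S (T x)) \in bounded_linear.
Proof.
apply/bounded_linearP; split; first by move=> a x y; rewrite !linearP.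
have [_ [M SM]] := bopP S; have [_ [N TN]] := bopP T.
exists (`|M| * N) => x; rewrite rmorphM /= -mulrA.
apply: le_trans (SM _) _.
apply: (@le_trans _ _ (`|M|%:C * `|T x|)).
  by apply: ler_wpM2r => //; rewrite lecR ler_norm.
by apply: ler_wpM2l => //; rewrite ler0c.
Qed.

Definition bop_one := Bop bop_one_subproof.
Definition bop_mul S T := Bop (bop_mul_subproof S T).

Fact bop_mulA : associative bop_mul. Proof. by move=> S T U; exact: bop_eqP. Qed.
Fact bop_mul1 : left_id bop_one bop_mul. Proof. by move=> T; exact: bop_eqP. Qed.
Fact bop_mulr1 : right_id bop_one bop_mul. Proof. by move=> T; exact: bop_eqP. Qed.
Fact bop_mulDl : left_distributive bop_mul +%R.
Proof. by move=> S T U; exact: bop_eqP. Qed.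
Fact bop_mulDr : right_distributive bop_mul +%R.
Proof. by move=> S T U; apply: bop_eqP => x /=; rewrite linearD. Qed.

HB.instance Definition _ := GRing.Zmodule_isPzRing.Build bop
  bop_mulA bop_mul1 bop_mulr1 bop_mulDl bop_mulDr.

Lemma bop1E x : (1 : bop) x = x. Proof. by []. Qed.
Lemma bopME S T x : (S * T) x = S (T x). Proof. by []. Qed.

Let opset T : set R := [set complex.Re `|T x| | x in [set x : H | `|x| <= 1]].

(* Norms of a complex normed module take values in R[i] in this library, so the
   real supremum has to be injected there. *)
Definition opnorm T : R[i] := (sup (opset T))%:C.

Lemma opset_sup T : has_sup (opset T).
Proof.
split; first by exists (complex.Re `|T 0|); exists 0 => //=; rewrite normr0.
have [_ [M TM]] := bopP T; exists `|M| => _ [x /= x1 <-].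
suff : `|T x| <= `|M|%:C by rewrite complex_normE lecR.
apply: le_trans (TM x) _; apply: (@le_trans _ _ (`|M|%:C * `|x|)).
  by apply: ler_wpM2r => //; rewrite lecR ler_norm.
by rewrite ler_piMr// ler0c.
Qed.

Lemma opnorm_ge0 T : 0 <= opnorm T.
Proof.
rewrite ler0c; have -> : 0 = complex.Re `|T 0| :> R by rewrite linear0 normr0.
by apply: sup_upper_bound; [exact: opset_sup | exists 0 => //=; rewrite normr0].
Qed.

Lemma le_opnorm T x : `|T x| <= opnorm T * `|x|.
Proof.
have [->|x0] := eqVneq x 0; first by rewrite linear0 !normr0 mulr0.
have nx0 : 0 < `|x| by rewrite normr_gt0.
rewrite -ler_pdivrMr// mulrC -[X in X * _]ger0_norm ?invr_ge0//.
rewrite -normrZ -linearZ complex_normE lecR.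
apply: sup_upper_bound; first exact: opset_sup.
exists (`|x|^-1 *: x) => //=.
by rewrite normrZ ger0_norm ?invr_ge0// mulVf ?gt_eqF.
Qed.

Lemma opnorm_le T (M : R[i]) :
  0 <= M -> (forall x, `|T x| <= M * `|x|) -> opnorm T <= M.
Proof.
move=> M0 TM; have ME : M = (complex.Re M)%:C.
  by rewrite -(ger0_norm M0) [LHS]complex_normE.
rewrite ME lecR; apply: ge_sup; first exact: (opset_sup T).1.
move=> _ [x /= x1 <-]; rewrite -lecR -complex_normE -ME.
by apply: le_trans (TM x) _; rewrite ler_piMr.
Qed.

Fact opnormD S T : opnorm (S + T) <= opnorm S + opnorm T.
Proof.
apply: opnorm_le => [|x]; first by rewrite addr_ge0 ?opnorm_ge0.
rewrite mulrDl; apply: le_trans (ler_normD _ _) _.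
by apply: lerD; exact: le_opnorm.
Qed.

Let opnormZ_le (c : R[i]) T : opnorm (c *: T) <= `|c| * opnorm T.
Proof.
apply: opnorm_le => [|x]; first by rewrite mulr_ge0 ?opnorm_ge0.
by rewrite bopZE normrZ -mulrA ler_wpM2l ?le_opnorm.
Qed.

Fact opnormZ (c : R[i]) T : opnorm (c *: T) = `|c| * opnorm T.
Proof.
apply/eqP; rewrite eq_le opnormZ_le /=.
have [->|c0] := eqVneq c 0; first by rewrite normr0 mul0r opnorm_ge0.
rewrite -ler_pdivlMl ?normr_gt0// -normfV.
by rewrite -[in leLHS](scalerK c0 T) opnormZ_le.
Qed.

Fact opnorm0_eq0 T : opnorm T = 0 -> T = 0.
Proof.
move=> T0; apply: bop_eqP => x; apply/eqP; rewrite -normr_eq0 eq_le normr_ge0.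
by rewrite andbT -(mul0r `|x|) -T0 le_opnorm.
Qed.

HB.instance Definition _ := Lmodule_isNormed.Build R[i] bop
  opnormD opnormZ opnorm0_eq0.

Lemma bop_normE T : `|T| = opnorm T. Proof. by []. Qed.

(* The adjoint of a bounded operator exists (Riesz) and is unique. *)
Definition adj T : bop :=
  xget 0 [set S : bop | forall x y, inner (T x) y = inner x (S y)].

Lemma adj_eq T (S : bop) :
  (forall x y, inner (T x) y = inner x (S y)) -> adj T = S.
Proof.
move=> TS; apply: xget_unique => // S' TS'; apply: bop_eqP => y.
apply/eqP; rewrite -subr_eq0 -normr_eq0 -sqrf_eq0 -inner_norm linearBr.
by rewrite subr_eq0; apply/eqP; exact: etrans (esym (TS' _ _)) (TS _ _).
Qed.

Lemma adj1 : adj 1 = 1. Proof. exact: adj_eq. Qed.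

Definition is_projection T : Prop := T * T = T /\ adj T = T.

Definition unitary T : Prop := adj T * T = 1 /\ T * adj T = 1.

Definition compactop : {pred bop} := fun T =>
  `[< precompact (T @` [set x : H | `|x| <= 1]) >].

Lemma compactopP T :
  reflect (precompact (T @` [set x : H | `|x| <= 1])) (T \in compactop).
Proof. exact: asboolP. Qed.

Lemma compactop_zmod : zmod_closed compactop.
Proof.
split.
  apply/compactopP; apply: (@precompact_subset _ _ [set 0]).
    by move=> _ [x _ <-].
  exists [set 0] => //; split; first exact: compact_set1.
  by apply: compact_closed; [exact: norm_hausdorff | exact: compact_set1].
move=> S T /compactopP[A SA [cA _]] /compactopP[B TB [cB _]].
apply/compactopP.
pose D := (fun z : H * H => z.1 - z.2) @` (A `*` B).
have cD : compact D.
  apply: continuous_compact; last exact: compact_setX.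
  apply: continuous_subspaceT => z; exact: sub_continuous.
exists D; last by split=> //; apply: compact_closed => //; exact: norm_hausdorff.
by move=> _ [x x1 <-]; exists (S x, T x) => //; split; [apply: SA|apply: TB];
  exists x.
Qed.

HB.instance Definition _ := GRing.isZmodClosed.Build bop compactop compactop_zmod.

(* The library quotients noncommutative rings by two-sided ideals only as
   additive groups, which is all that is used here. *)
Definition calkin := Quotient.quot compactop.

Definition calkin_pi (T : bop) : calkin := \pi_calkin T.

Lemma calkin_piP S T : calkin_pi S = calkin_pi T <-> S - T \in compactop.
Proof.
by rewrite Quotient.idealrBE; split=> [?|/eqP//]; exact/eqP.
Qed.

Lemma calkin_pi0 : calkin_pi 0 = 0.
Proof. by rewrite /calkin_pi piE. Qed.

Definition P_inf : set bop :=
  [set P | [/\ is_projection P,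
               infinite_dim (range P)
             & infinite_dim [set x : H | P x = 0]]].

Definition C_inf (P : bop) : set bop :=
  [set Q | [/\ is_projection Q,
               P * Q \in compactop,
               calkin_pi ((1 - P) * (1 - Q) * (1 - P)) <> calkin_pi (1 - P)
             & calkin_pi ((1 - P) * (1 - Q) * (1 - P)) <> 0]].

Definition C_inf_pairs : set (bop * bop) :=
  [set PQ | P_inf PQ.1 /\ C_inf PQ.1 PQ.2].

Definition U_res (P : bop) : set bop :=
  [set U | unitary U /\ U * P - P * U \in compactop].

Definition U_res0 (P : bop) : set bop := connected_component (U_res P) 1.

End BoundedOperators.

Arguments C_inf_pairs {R} H.

Notation "''B(' H )" := (bop H) (format "''B(' H )") : type_scope.

(* Main.v *)
Require Import Defs.
From mathcomp Require Import all_boot all_order all_algebra.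
From mathcomp Require Import all_classical all_reals all_analysis complex.
From mathcomp Require Import lra.

(* No spectral theory is needed. If [a] and [b] are mutually orthogonal
   orthonormal sequences, the partial isometry v : a_n |-> b_n yields the
   symmetry S = v + v* + (1 - p - q), which exchanges the projections p and q on
   the closed spans of [a] and [b]; cos t + i sin t S is a path of unitaries
   from 1 to iS, and conjugation by iS is conjugation by S. If P p and P q are
   compact, this path stays in U_res(P). To move Q to Q' in C_inf(P), choose
   orthonormal x_n in N(Q) and y_n in N(Q'), all mutually orthogonal, with
   |P x_n| and |P y_n| at most 4^-n, so that P X and P Y are compact for the
   projections X and Y on their spans, and swap Q -> X -> Y -> Q'. Such vectors
   exist because (1 - Q)(1 - P) is not compact while P (1 - Q)(1 - P) is. With
   P = 0 the same argument moves any element of P_inf to any other one, which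
   reduces the connectedness of C_inf_pairs to that of a single C_inf(P). *)

Set Implicit Arguments.
Unset Strict Implicit.
Unset Printing Implicit Defensive.

Import Order.TTheory GRing.Theory Num.Theory.
Import numFieldNormedType.Exports.
Local Open Scope ring_scope.

Section HilbertSpace.
Local Open Scope classical_set_scope.
Local Open Scope complex_scope.

Variables (R : realType) (H : hilbertType R).
(** * Orthonormal families *)

Section InnerProduct.
Implicit Types (x y z : H) (a b c : nat -> H).

Lemma gt0_ReE (e : R[i]) : 0 < e -> e = (complex.Re e)%:C.
Proof. by move=> e0; rewrite -(gtr0_norm e0) [LHS]complex_normE. Qed.

Lemma innerC x y : inner x y = (inner y x)^*%R.
Proof. by rewrite hermC mul1r. Qed.

Lemma innerDl x y z : inner (x + y) z = inner x z + inner y z.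
Proof. exact: linearDl. Qed.

Lemma innerDr x y z : inner x (y + z) = inner x y + inner x z.
Proof. exact: linearDr. Qed.

Lemma innerZl (k : R[i]) x y : inner (k *: x) y = k * inner x y.
Proof. exact: linearZl_LR. Qed.

Lemma innerZr (k : R[i]) x y : inner x (k *: y) = k^*%R * inner x y.
Proof. exact: linearZr_LR. Qed.

Lemma innerBl x y z : inner (x - y) z = inner x z - inner y z.
Proof. exact: linearBl. Qed.

Lemma innerBr x y z : inner x (y - z) = inner x y - inner x z.
Proof. exact: linearBr. Qed.

Lemma innerNl x y : inner (- x) y = - inner x y.
Proof. exact: linearNl. Qed.

Lemma innerNr x y : inner x (- y) = - inner x y.
Proof. exact: linearNr. Qed.

Lemma inner_suml I (r : seq I) (P : pred I) (F : I -> H) y :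
  inner (\sum_(i <- r | P i) F i) y = \sum_(i <- r | P i) inner (F i) y.
Proof. exact: linear_sumlz. Qed.

Lemma inner_sumr I (r : seq I) (P : pred I) (F : I -> H) y :
  inner y (\sum_(i <- r | P i) F i) = \sum_(i <- r | P i) inner y (F i).
Proof. exact: linear_sumr. Qed.

Lemma inner_eq0C x y : inner x y = 0 -> inner y x = 0.
Proof. by move=> xy0; rewrite innerC xy0 conjC0. Qed.

Lemma normDd x y : inner x y = 0 -> `|x + y| ^+ 2 = `|x| ^+ 2 + `|y| ^+ 2.
Proof. by move=> xy0; rewrite -!inner_norm hnormDd. Qed.

(** A finite family is kept as a sequence cut at [n], so that the same lemmas serve a list through
    [nth 0 s] and the initial segments of an infinite sequence. *)
Definition orthonormal_upto n a :=
  forall i j, (i < n)%N -> (j < n)%N -> inner (a i) (a j) = (i == j)%:R.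

Definition orthonormal_seq a := forall i j, inner (a i) (a j) = (i == j)%:R.

Definition orthogonal_seq a b := forall i j, inner (a i) (b j) = 0.

Lemma orthogonal_seq_sym a b : orthogonal_seq a b -> orthogonal_seq b a.
Proof. by move=> ab i j; exact: inner_eq0C. Qed.

Lemma norm_orthonormal n a i : orthonormal_upto n a -> (i < n)%N -> `|a i| = 1.
Proof.
move=> oa lt_in; apply/eqP; rewrite -(@pexpr_eq1 _ _ 2)// -inner_norm oa//.
by rewrite eqxx.
Qed.

(** The lower bound [m] is arbitrary because blocks of the series, not only partial sums, enter the
    Cauchy criterion later on. *)
Lemma pythagoras m n a (k : nat -> R[i]) : orthonormal_upto n a ->
  `|\sum_(m <= i < n) k i *: a i| ^+ 2 = \sum_(m <= i < n) `|k i| ^+ 2.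
Proof.
elim: n => [|n IHn] oa; first by rewrite !big_geq// normr0 expr0n.
have [lt_nm|le_mn] := ltnP n m; first by rewrite !big_geq// normr0 expr0n.
rewrite !big_nat_recr//= normDd ?IHn.
- by rewrite normrZ (norm_orthonormal oa)// mulr1.
- by move=> i j lt_in lt_jn; apply: oa; apply: ltnW.
rewrite inner_suml big_nat big1// => i /andP[_ lt_in].
rewrite innerZl innerZr oa ?(ltnW lt_in)//; last by rewrite ltnS ltnW.
by rewrite ltn_eqF// !mulr0.
Qed.

Lemma inner_proj n a x j : orthonormal_upto n a -> (j < n)%N ->
  inner (\sum_(0 <= i < n) inner x (a i) *: a i) (a j) = inner x (a j).
Proof.
move=> oa lt_jn; rewrite inner_suml big_mkord (bigD1 (Ordinal lt_jn))//=.
rewrite innerZl oa// eqxx mulr1 big1 ?addr0// => i ne_ij.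
by rewrite innerZl oa// (_ : (i == j :> nat) = false) ?mulr0//; exact/negbTE.
Qed.

Lemma inner_residue n a x j : orthonormal_upto n a -> (j < n)%N ->
  inner (x - \sum_(0 <= i < n) inner x (a i) *: a i) (a j) = 0.
Proof. by move=> oa lt_jn; rewrite innerBl inner_proj// subrr. Qed.

(** The residue is orthogonal to every [a i], hence to the sum subtracted. Dropping one of the two
    terms gives Bessel's inequality or the contraction bound for the residue. *)
Lemma norm_residue n a x : orthonormal_upto n a ->
  `|x| ^+ 2 = `|x - \sum_(0 <= i < n) inner x (a i) *: a i| ^+ 2
              + \sum_(0 <= i < n) `|inner x (a i)| ^+ 2.
Proof.
move=> oa; rewrite -(pythagoras _ _ oa) -normDd ?subrK//.
rewrite inner_sumr big_nat big1// => i lt_in.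
by rewrite innerZr inner_residue// mulr0.
Qed.

Lemma bessel n a x : orthonormal_upto n a ->
  \sum_(0 <= i < n) `|inner x (a i)| ^+ 2 <= `|x| ^+ 2.
Proof. by move=> oa; rewrite (norm_residue x oa) lerDr exprn_ge0. Qed.

Lemma norm_residue_le n a x : orthonormal_upto n a ->
  `|x - \sum_(0 <= i < n) inner x (a i) *: a i| <= `|x|.
Proof.
move=> oa; rewrite -(@ler_pXn2r _ 2)// ?nnegrE//.
by rewrite (norm_residue x oa) lerDl sumr_ge0// => i _; rewrite exprn_ge0.
Qed.

Lemma norm_inner_unit x y : `|y| = 1 -> `|inner x y| <= `|x|.
Proof.
move=> y1; rewrite -(@ler_pXn2r _ 2)// ?nnegrE//.
have := @bessel 1 (fun=> y) x; rewrite big_nat1; apply.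
by case=> [|//] [|//] _ _; rewrite eqxx inner_norm y1 expr1n.
Qed.

Lemma cauchy_schwarz x y : `|inner x y| <= `|x| * `|y|.
Proof.
have [->|y0] := eqVneq y 0; first by rewrite linear0r !normr0 mulr0.
have ny : `|y| != 0 by rewrite normr_eq0.
have {1}-> : y = `|y| *: (`|y|^-1 *: y) by rewrite scalerA mulfV// scale1r.
rewrite innerZr normrM norm_conjC normr_id mulrC ler_wpM2r//.
by apply: norm_inner_unit; rewrite normrZ normfV normr_id mulVf.
Qed.

Lemma normalized x : x != 0 -> `| `|x|^-1 *: x| = 1.
Proof. by move=> x0; rewrite normrZ normfV normr_id mulVf// normr_eq0. Qed.

Lemma orthonormal_rcons (s : seq H) x :
    orthonormal_upto (size s) (nth 0 s) ->
    {in s, forall y, inner x y = 0} -> `|x| = 1 ->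
  orthonormal_upto (size (rcons s x)) (nth 0 (rcons s x)).
Proof.
move=> os xs x1 i j; rewrite size_rcons !ltnS !nth_rcons.
rewrite leq_eqVlt => /predU1P[->|lt_is]; rewrite leq_eqVlt;
  move=> /predU1P[->|lt_js]; rewrite ?ltnn ?eqxx.
- by rewrite inner_norm x1 expr1n.
- by rewrite lt_js xs ?mem_nth// gtn_eqF.
- by rewrite lt_is inner_eq0C ?xs ?mem_nth// ltn_eqF.
- by rewrite lt_is lt_js os.
Qed.

(** One Gram-Schmidt step: [e] is the normalized residue, and [inner x e] equals [inner r e], that
    is the norm of [r], because the part removed from [x] is orthogonal to [e]. *)
Lemma orthonormal_residue (t : seq H) x (r : H) :
    orthonormal_upto (size t) (nth 0 t) ->
    r = x - \sum_(0 <= i < size t) inner x (nth 0 t i) *: nth 0 t i ->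
    r != 0 ->
  exists e : H, [/\ {in t, forall y, inner e y = 0}, `|e| = 1,
    r = inner x e *: e & e = `|r|^-1 *: r].
Proof.
move=> ot rE r0; pose e := `|r|^-1 *: r.
have er : {in t, forall y, inner e y = 0}.
  by move=> y /(nthP 0)[j lt_jt <-]; rewrite innerZl rE inner_residue// mulr0.
exists e; split=> //; first exact: normalized.
have -> : inner x e = inner r e.
  rewrite rE innerBl [X in _ - X](_ : _ = 0) ?subr0// inner_suml.
  rewrite big_nat big1// => i lt_it.
  by rewrite innerZl [inner _ e]inner_eq0C ?mulr0// er// mem_nth.
rewrite innerZr inner_norm conj_Creal ?realV ?normr_real// expr2.
by rewrite mulKf ?normr_eq0// scalerA mulfV ?normr_eq0// scale1r.
Qed.

Lemma sum_nth_rcons (t : seq H) e (F : H -> H) :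
  \sum_(0 <= i < size (rcons t e)) F (nth 0 (rcons t e) i) =
  \sum_(0 <= i < size t) F (nth 0 t i) + F e.
Proof.
rewrite size_rcons big_nat_recr//= nth_rcons ltnn eqxx; congr (_ + _).
by apply: eq_big_nat => i /andP[_ lt_it]; rewrite nth_rcons lt_it.
Qed.

Lemma expand_rcons (t : seq H) e y :
    {in t, forall z, inner e z = 0} ->
    y = \sum_(0 <= i < size t) inner y (nth 0 t i) *: nth 0 t i ->
  y = \sum_(0 <= i < size (rcons t e))
        inner y (nth 0 (rcons t e) i) *: nth 0 (rcons t e) i.
Proof.
move=> et yE; rewrite (sum_nth_rcons t e (fun z => inner y z *: z)).
suff -> : inner y e = 0 by rewrite scale0r addr0 -yE.
rewrite yE inner_suml big_nat big1// => i lt_it.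
by rewrite innerZl [inner _ e]inner_eq0C ?mulr0// et// mem_nth.
Qed.

(** Gram-Schmidt, in which a vector with zero residue is skipped; [t] may therefore be shorter than
    [s]. *)
Lemma orthonormalize (s : seq H) : exists2 t : seq H,
  orthonormal_upto (size t) (nth 0 t) &
  {in s, forall x,
    x = \sum_(0 <= i < size t) inner x (nth 0 t i) *: nth 0 t i}.
Proof.
elim: s => [|x s [t ot st]]; first by exists [::].
set r := x - \sum_(0 <= i < size t) inner x (nth 0 t i) *: nth 0 t i.
have [r0|r0] := eqVneq r 0.
  exists t => // y; rewrite inE => /predU1P[->|]; last exact: st.
  exact: subr0_eq r0.
have [e [et e1 rE _]] := orthonormal_residue ot erefl r0.
exists (rcons t e); first exact: orthonormal_rcons.
move=> y; rewrite inE => /predU1P[->|/st]; last exact: expand_rcons.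
by rewrite (sum_nth_rcons t e (fun z => inner x z *: z)) -rE addrC subrK.
Qed.

End InnerProduct.

(** * The partial isometries x |-> sum_n <x, a_n> b_n *)

Section PartialIsometry.
Implicit Types (x y z : H) (a b c : nat -> H) (T : 'B(H)).

Lemma le_cvg_norm (V : normedModType R[i]) (u : nat -> V) (l : V) (M : R[i]) :
  u n @[n --> \oo] --> l -> (forall n, `|u n| <= M) -> `|l| <= M.
Proof.
move=> /cvgrPdist_le ul uM; apply/ler_addgt0Pr => e e0.
have [n _ /(_ n (leqnn n)) le_e] := ul _ e0.
rewrite -(subrK (u n) l) addrC; apply: le_trans (ler_normD _ _) _.
by apply: lerD.
Qed.

Lemma bop_cvg T (u : nat -> H) (l : H) :
  u n @[n --> \oo] --> l -> T (u n) @[n --> \oo] --> T l.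
Proof.
move=> /cvgrPdist_lt ul; apply/cvgrPdist_lt => e e0.
have k0 : 0 < `|T| + 1 by rewrite ltr_wpDl.
have := ul (e / (`|T| + 1)) (divr_gt0 e0 k0); apply: filterS => n.
rewrite ltr_pdivlMr// => lt_e; rewrite -linearB.
apply: le_lt_trans lt_e; apply: le_trans (le_opnorm _ _) _.
by rewrite mulrC ler_wpM2l// -bop_normE lerDl.
Qed.

Lemma inner_cvg (u : nat -> H) (l : H) z :
  u n @[n --> \oo] --> l -> inner (u n) z @[n --> \oo] --> inner l z.
Proof.
move=> /cvgrPdist_lt ul; apply/cvgrPdist_lt => e e0.
have k0 : 0 < `|z| + 1 by rewrite ltr_wpDl.
have := ul (e / (`|z| + 1)) (divr_gt0 e0 k0); apply: filterS => n.
rewrite ltr_pdivlMr// => lt_e; rewrite -innerBl.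
apply: le_lt_trans lt_e; apply: le_trans (cauchy_schwarz _ _) _.
by rewrite ler_wpM2l// lerDl.
Qed.

Lemma cvg_conj (C : numClosedFieldType) (u : nat -> C) (l : C) :
  u n @[n --> \oo] --> l -> (u n)^*%R @[n --> \oo] --> l^*%R.
Proof.
move=> /cvgrPdist_lt ul; apply/cvgrPdist_lt => e /ul; apply: filterS => n.
by rewrite -rmorphB norm_conjC.
Qed.

Lemma eq_seq_lim (K : numFieldType) (V : pseudoMetricNormedZmodType K)
    (u v : nat -> V) (l m : V) :
  u n @[n --> \oo] --> l -> v n @[n --> \oo] --> m -> u =1 v -> l = m.
Proof.
move=> + + /funext uv; rewrite uv => vl vm.
exact: (@cvg_unique _ (@norm_hausdorff _ V) _ _ _ _ vl vm).
Qed.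

Definition pisom_sum a b y : nat -> H :=
  series (fun n => inner y (a n) *: b n).

(* The default value 0 is only reached when a or b fails to be orthonormal. *)
Definition pisom a b : 'B(H) :=
  xget 0 [set T : 'B(H) | forall y, pisom_sum a b y n @[n --> \oo] --> T y].

Lemma upto_seq n a : orthonormal_seq a -> orthonormal_upto n a.
Proof. by move=> oa i j _ _; exact: oa. Qed.

Lemma norm_pisom_sum a b y n : orthonormal_seq a -> orthonormal_seq b ->
  `|pisom_sum a b y n| <= `|y|.
Proof.
move=> oa ob; rewrite -(@ler_pXn2r _ 2)// ?nnegrE//.
rewrite /pisom_sum /series/= (pythagoras _ _ (upto_seq ob)).
exact: bessel (upto_seq oa).
Qed.

(** By Pythagoras the squared norm of a block is a block of the real series of the [r k], which is
    monotone and bounded by Bessel. Its Cauchy criterion at [e ^+ 2] gives the one sought at [e]. *)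
Lemma cvg_pisom_sum a b y : orthonormal_seq a -> orthonormal_seq b ->
  cvg (pisom_sum a b y n @[n --> \oo]).
Proof.
move=> oa ob; apply: cauchy_cvg; apply/cauchy_seriesP => e e0.
have reX (V : normedZmodType R[i]) (v : V) :
    (complex.Re `|v| ^+ 2)%:C = `|v| ^+ 2.
  by rewrite [in RHS]complex_normE -rmorphXn.
pose r k : R := complex.Re `|inner y (a k)| ^+ 2.
have rE m n : (\sum_(m <= k < n) r k)%:C =
    `|\sum_(m <= k < n) inner y (a k) *: b k| ^+ 2.
  rewrite (pythagoras _ _ (upto_seq ob)) rmorph_sum/=.
  by apply: eq_bigr => k _; exact: reX.
have r0 k : 0 <= r k by rewrite /r exprn_even_ge0.
have cr : cvgn (series r).
  apply: nondecreasing_is_cvgn.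
    by apply/nondecreasing_seqP => n; rewrite /series/= big_nat_recr//= lerDl.
  exists (complex.Re `|y| ^+ 2) => _ [n _ <-].
  rewrite -lecR rE reX.
  by rewrite (pythagoras _ _ (upto_seq ob)) (bessel _ (upto_seq oa)).
have ee := gt0_ReE e0.
have e'0 : 0 < complex.Re e by rewrite -ltcR -ee.
move/cvg_cauchy/cauchy_seriesP/(_ _ (exprn_gt0 2 e'0)): cr.
apply: filterS => -[m n]/=; rewrite ger0_norm ?sumr_ge0//.
rewrite -ltcR rE rmorphXn/= -ee => lt_e.
by rewrite -(@ltr_pXn2r _ 2)// ?nnegrE// ltW.
Qed.

(** The partial sums are linear in [y] and bounded by the norm of [y], so their pointwise limit is a
    bounded operator. This rules out the default value in [pisom]. *)
Lemma pisom_cvg a b y : orthonormal_seq a -> orthonormal_seq b ->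
  pisom_sum a b y n @[n --> \oo] --> pisom a b y.
Proof.
move=> oa ob; pose f x := lim (pisom_sum a b x n @[n --> \oo]).
have fP x : pisom_sum a b x n @[n --> \oo] --> f x by exact: cvg_pisom_sum.
have f_bounded : f \in @bounded_linear R H.
  apply/bounded_linearP; split=> [k u v|]; last first.
    exists 1 => x; rewrite mul1r; apply: le_cvg_norm (fP x) _ => n.
    exact: norm_pisom_sum.
  have fD : k *: pisom_sum a b u n + pisom_sum a b v n @[n --> \oo]
      --> k *: f u + f v.
    by apply: cvgD (fP v); exact: cvgZ (cvg_cst k) (fP u).
  apply: eq_seq_lim (fP _) fD _ => n.
  rewrite /pisom_sum /series/= scaler_sumr -big_split/=.
  by apply: eq_bigr => i _; rewrite innerDl innerZl scalerDl scalerA.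
have : exists T : 'B(H), forall x, pisom_sum a b x n @[n --> \oo] --> T x.
  by exists (Bop f_bounded) => x; exact: fP.
by move=> /(xgetPex 0); apply.
Qed.

(** The identity holds for partial sums. Limits are taken in the first argument of [inner], so the
    right-hand side is conjugated first. *)
Lemma adj_pisom a b y z : orthonormal_seq a -> orthonormal_seq b ->
  inner (pisom a b y) z = inner y (pisom b a z).
Proof.
move=> oa ob; have cz := inner_cvg (z := y) (pisom_cvg (y := z) ob oa).
have cy := inner_cvg (z := z) (pisom_cvg (y := y) oa ob).
rewrite [RHS]innerC; have cz' := cvg_conj cz.
refine (eq_seq_lim cy cz' _) => n.
rewrite !inner_suml rmorph_sum/=; apply: eq_bigr => i _.
by rewrite !innerZl rmorphM/= -!innerC mulrC.
Qed.

Lemma bop_pisom T a b c y : orthonormal_seq a -> orthonormal_seq b ->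
  orthonormal_seq c -> (forall n, T (b n) = c n) ->
  T (pisom a b y) = pisom a c y.
Proof.
move=> oa ob oc Tbc; have cy := bop_cvg (T := T) (pisom_cvg (y := y) oa ob).
refine (eq_seq_lim cy (pisom_cvg oa oc) _) => n.
rewrite /pisom_sum /series/= linear_sum.
by apply: eq_bigr => i _; rewrite linearZ/= Tbc.
Qed.

Lemma bop_pisom0 T a b y : orthonormal_seq a -> orthonormal_seq b ->
  (forall n, T (b n) = 0) -> T (pisom a b y) = 0.
Proof.
move=> oa ob Tb; have cy := bop_cvg (T := T) (pisom_cvg (y := y) oa ob).
refine (eq_seq_lim cy (cvg_cst 0) _) => n.
rewrite /pisom_sum /series/= linear_sum big1// => i _.
by rewrite linearZ/= Tb scaler0.
Qed.

Lemma pisom_eq0 a b y : orthonormal_seq a -> orthonormal_seq b ->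
  (forall n, inner y (a n) = 0) -> pisom a b y = 0.
Proof.
move=> oa ob ya; refine (eq_seq_lim (pisom_cvg oa ob) (cvg_cst 0) _) => n.
by rewrite /pisom_sum /series/= big1// => i _; rewrite ya scale0r.
Qed.

Lemma pisom_nth a b n : orthonormal_seq a -> orthonormal_seq b ->
  pisom a b (a n) = b n.
Proof.
move=> oa ob.
apply: (@cvg_unique _ (@norm_hausdorff _ H) _ _ _ _ (pisom_cvg oa ob)).
(* Only the term of index [n] survives, and the partial sums contain it from [n.+1] on. *)
apply: cvg_near_cst; exists n.+1 => //= m /= lt_nm.
rewrite /pisom_sum /series/= big_mkord (bigD1 (Ordinal lt_nm))//=.
rewrite oa eqxx scale1r big1 ?addr0// => i ne_in.
rewrite oa (_ : (n == i) = false) ?scale0r//.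
by rewrite eq_sym; apply/negbTE.
Qed.

Lemma pisomM a b c : orthonormal_seq a -> orthonormal_seq b ->
  orthonormal_seq c -> pisom b c * pisom a b = pisom a c.
Proof.
move=> oa ob oc; apply: bop_eqP => y; rewrite bopME.
by apply: bop_pisom => // n; exact: pisom_nth.
Qed.

Lemma pisomM0 a b c d : orthonormal_seq a -> orthonormal_seq b ->
    orthonormal_seq c -> orthonormal_seq d -> orthogonal_seq b c ->
  pisom c d * pisom a b = 0.
Proof.
move=> oa ob oc od obc; apply: bop_eqP => y; rewrite bopME.
by apply: bop_pisom0 => // n; apply: pisom_eq0.
Qed.

End PartialIsometry.

(** * Compact operators *)

Section Compactness.
Implicit Types (x y z : H) (S T : 'B(H)) (s : seq H).

(** Pigeonhole for ultrafilters: if no member of a finite union belongs to [F], all the complements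
    do. *)
Lemma ultra_has (X : Type) (I : eqType) (F : set_system X) (s : seq I)
    (P : I -> set X) : UltraFilter F ->
    F [set x | exists2 i, i \in s & P i x] -> exists2 i, i \in s & F (P i).
Proof.
move=> UF; elim: s => [|i s IHs] Fs.
  by have [x []] := filter_ex Fs.
have [FP|FnP] := in_ultra_setVsetC (P i) UF.
  by exists i => //; exact: mem_head.
have [j js Fj] : exists2 j, j \in s & F (P j).
  apply: IHs; apply: filterS2 Fs FnP => x [j + Pj] nPi.
  by rewrite inE => /predU1P[ji|js]; [rewrite ji in Pj | exists j].
by exists j => //; rewrite inE js orbT.
Qed.

(** Compactness is total boundedness of the image of the unit ball. In the converse, an ultrafilter
    on the closure contains a small ball around some point of each net, hence is Cauchy, and [H] is
    complete. *)
Lemma compactop_nets T :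
  T \in @compactop R H <->
  forall e, 0 < e -> exists s, forall x, `|x| <= 1 ->
    exists2 z, z \in s & `|T x - z| <= e.
Proof.
split=> [/compactopP[K AK [cK _]] e e0|Tnet].
  rewrite compact_cover in cK.
  have [||D _ KD] := cK H [set: H] (fun z => ball z e).
  - by move=> z _; exact: ball_open.
  - by move=> z _; exists z => //; exact: ballxx.
  exists (finmap.enum_fset D) => x x1.
  have /KD[z /= zD] : K (T x) by apply: AK; exists x.
  by rewrite -ball_normE /= distrC => /ltW; exists z.
apply/compactopP; rewrite precompactE compact_ultra => F UF FA.
have /cauchy_cvg/cvg_ex[l Fl] : cauchy F.
  apply: cauchy_exP => e e0; have e3 : 0 < e / 3 by rewrite divr_gt0.
  have [s sT] := Tnet _ e3.
  (* One third of [e] approximates a point of the closure by some [T x], and another third is the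
     radius of the net; the sum is strictly below [e]. *)
  have [] := @ultra_has _ _ F s (fun z => [set p | `|p - z| <= e / 3 + e / 3]).
    apply: filterS FA => p clp.
    have nbp : nbhs p [set q | `|p - q| <= e / 3].
      by apply: filterS (nbhsx_ballx p _ e3) => q; rewrite -ball_normE => /ltW.
    have [_ [[x x1 <-] px]] := clp _ nbp; have [z zs Txz] := sT x x1.
    exists z => //=; rewrite -(subrK (T x) p) -addrA.
    by apply: le_trans (ler_normD _ _) _; exact: lerD.
  move=> z _ Fz; exists z; apply: filterS Fz => p /=.
  rewrite -ball_normE/= distrC => /le_lt_trans; apply.
  rewrite -mulrDl -mulr2n -[e *+ 2]mulr_natr -mulrA gtr_pMr//.
  by rewrite ltr_pdivrMr// mul1r ltr_nat.
exists l; split=> // U Ul.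
have [p [pA pU]] := filter_ex (filterI FA (Fl _ (nbhs_interior Ul))).
by have [q [qA qU]] := pA _ pU; exists q.
Qed.

Lemma compactop_mull S T : T \in @compactop R H -> S * T \in @compactop R H.
Proof.
move=> /compactop_nets Tnet; apply/compactop_nets => e e0.
have k0 : 0 < `|S| + 1 by rewrite ltr_wpDl.
have [s sT] := Tnet _ (divr_gt0 e0 k0).
exists [seq S z | z <- s] => x /sT[z zs le_e]; exists (S z).
  exact: map_f.
rewrite bopME -linearB; apply: le_trans (le_opnorm _ _) _.
rewrite ler_pdivlMr// in le_e; apply: le_trans le_e.
by rewrite mulrC ler_wpM2l// -bop_normE lerDl.
Qed.

Lemma compactop_mulr S T : T \in @compactop R H -> T * S \in @compactop R H.
Proof.
move=> /compactop_nets Tnet; apply/compactop_nets => e e0.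
pose k := `|S| + 1; have k0 : 0 < k by rewrite ltr_wpDl.
have [s sT] := Tnet _ (divr_gt0 e0 k0).
exists [seq k *: z | z <- s] => x x1.
have [|z zs le_e] := sT (k^-1 *: S x).
  rewrite normrZ normfV (gtr0_norm k0) ler_pdivrMl// mulr1.
  apply: le_trans (le_opnorm _ _) _; apply: (@le_trans _ _ (`|S| * 1)).
    by rewrite -bop_normE ler_wpM2l.
  by rewrite mulr1 lerDl.
exists (k *: z); first exact: map_f.
rewrite bopME -[S x](scalerKV (lt0r_neq0 k0)) linearZ/= -scalerBr normrZ.
by rewrite (gtr0_norm k0) mulrC -ler_pdivlMr.
Qed.

Lemma real_nets (e : R) : 0 < e -> exists s : seq R, forall r, `|r| <= 1 ->
  exists2 q, q \in s & `|r - q| <= e.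
Proof.
move=> e0; pose N := (Num.truncn e^-1).+1.
have N0 : 0 < N%:R :> R by rewrite ltr0n.
have Ne : N%:R^-1 <= e.
  rewrite -[e]invrK lef_pV2 ?posrE ?invr_gt0//.
  by have /andP[_ /ltW] := truncn_itv (ltW (etrans (invr_gt0 e) e0)).
(* A grid of mesh [N^-1] on the segment from -1 to 1; [m] is the integer part of [(r + 1) * N%:R],
   which is at most [2 * N]. *)
exists [seq m%:R / N%:R - 1 | m <- iota 0 (2 * N).+1] => r r1.
have [r_ge r_le] : -1 <= r /\ r <= 1 by move: r1; rewrite ler_norml => /andP[].
have r0 : 0 <= (r + 1) * N%:R by rewrite mulr_ge0// -lerBlDr sub0r.
have /andP[m_le m_gt] := truncn_itv r0.
set m := Num.truncn _ in m_le m_gt.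
exists (m%:R / N%:R - 1).
  apply/mapP; exists m => //; rewrite mem_iota add0n ltnS/= -(ler_nat R) natrM.
  apply: le_trans m_le _; rewrite ler_wpM2r//.
  by lra.
apply: le_trans Ne; rewrite opprB addrA.
have -> : r + 1 - m%:R / N%:R = ((r + 1) * N%:R - m%:R) / N%:R.
  by rewrite mulrBl mulfK// lt0r_neq0.
rewrite normrM normfV (gtr0_norm N0) ler_piMl ?invr_ge0 ?(ltW N0)//.
by rewrite ger0_norm ?subr_ge0// lerBlDr nat1r ltW.
Qed.

Lemma normC_real (r : R) : `|r%:C| = (`|r|)%:C :> R[i].
Proof. by rewrite normc_def/= expr0n addr0 sqrtr_sqr. Qed.

Lemma disc_nets (e : R[i]) : 0 < e ->
  exists s : seq R[i], forall c : R[i], `|c| <= 1 ->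
    exists2 k, k \in s & `|c - k| <= e.
Proof.
move=> e0; have e2 : 0 < e / 2 by rewrite divr_gt0.
have ee := gt0_ReE e2.
have [|s sP] := @real_nets (complex.Re (e / 2)); first by rewrite -ltcR -ee.
exists [seq p +i* q | p <- s, q <- s] => -[u v] uv1.
have part1 w : `|w|%:C <= `|u +i* v| -> `|w| <= 1.
  by move=> /le_trans/(_ uv1); rewrite -[1]/(1%:C) lecR.
have [|p sp up] := sP u.
  exact: part1 (normc_ge_Re _).
have [|q sq vq] := sP v.
  (* Multiplication by ['i] keeps the norm and turns the imaginary part into a real part, up to
     sign. *)
  apply: part1; have := normc_ge_Re ((u +i* v) * 'i).
  by rewrite ReiNIm normrN normrM normCi mulr1.
exists (p +i* q); first exact: allpairs_f.
have -> : (u +i* v) - (p +i* q) = (u - p)%:C + 'i * (v - q)%:C.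
  by simpc.
apply: le_trans (ler_normD _ _) _; rewrite [e]splitr normrM normCi mul1r.
by rewrite !normC_real ee; apply: lerD; rewrite lecR.
Qed.

(** Induction on [n]: half of [e] goes to the first vectors, and the last coefficient is
    approximated within the other half divided by [|v n| + 1]. *)
Lemma span_nets n (v : nat -> H) (e : R[i]) : 0 < e ->
  exists s, forall k : nat -> R[i], (forall i, (i < n)%N -> `|k i| <= 1) ->
    exists2 z, z \in s & `|\sum_(0 <= i < n) k i *: v i - z| <= e.
Proof.
elim: n e => [|n IHn] e e0.
  exists [:: 0] => k _; exists 0; first exact: mem_head.
  by rewrite big_geq// subr0 normr0 ltW.
have e2 : 0 < e / 2 by rewrite divr_gt0.
have [s sP] := IHn _ e2.
have v0 : 0 < `|v n| + 1 by rewrite ltr_wpDl.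
have [d dP] := disc_nets (divr_gt0 e2 v0).
exists [seq z + c *: v n | z <- s, c <- d] => k k1.
have [|z zs kz] := sP k; first by move=> i lt_in; apply/k1/ltnW.
have [c cd kc] := dP _ (k1 _ (ltnSn n)).
exists (z + c *: v n); first exact: allpairs_f.
rewrite big_nat_recr//= opprD addrACA -scalerBl.
apply: le_trans (ler_normD _ _) _; rewrite [e]splitr lerD// normrZ.
rewrite ler_pdivlMr// in kc; apply: le_trans kc.
by rewrite ler_wpM2l// lerDl.
Qed.

(* This and the next lemma characterize compactness by smallness on subspaces of
   finite codimension. *)
Lemma compactop_of_orthogonal T :
  (forall e, 0 < e -> exists s, forall y, {in s, forall z, inner y z = 0} ->
     `|T y| <= e * `|y|) ->
  T \in @compactop R H.
Proof.
move=> small; apply/compactop_nets => e e0.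
have e2 : 0 < e / 2 by rewrite divr_gt0.
have [s sT] := small _ e2; have [t ot st] := orthonormalize s.
have [L LP] := span_nets (size t) (fun i => T (nth 0 t i)) e2.
exists L => x x1; have [|z zL le_z] := LP (fun i => inner x (nth 0 t i)).
  move=> i lt_it; apply: le_trans x1; apply: norm_inner_unit.
  exact: norm_orthonormal ot lt_it.
exists z => //; rewrite [e]splitr.
(* [x - p] is orthogonal to [s], where [T] is small; [T p] has coefficients of norm at most 1 and is
   covered by the net [L]. *)
set p := \sum_(0 <= i < size t) inner x (nth 0 t i) *: nth 0 t i.
have -> : T x = T (x - p) +
    \sum_(0 <= i < size t) inner x (nth 0 t i) *: T (nth 0 t i).
  rewrite -[in LHS](subrK p x) linearD; congr (_ + _).
  rewrite /p linear_sum.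
  by apply: eq_bigr => i _; rewrite linearZ.
rewrite -addrA; apply: le_trans (ler_normD _ _) _; apply: lerD => //.
apply: le_trans (sT _ _) _.
  move=> y /st ->; rewrite inner_sumr big_nat big1// => i lt_it.
  by rewrite innerZr (inner_residue _ ot)// mulr0.
rewrite ler_piMr ?(ltW e2)//; apply: le_trans x1.
exact: norm_residue_le.
Qed.

Lemma compactop_orthogonal T S : T \in @compactop R H ->
    (forall x y, inner (T x) y = inner x (S y)) ->
  forall e, 0 < e -> exists s, forall y, {in s, forall z, inner y z = 0} ->
    `|T y| <= e * `|y|.
Proof.
move=> /compactop_nets Tnet TS e e0; have [s sT] := Tnet e e0.
exists [seq S z | z <- s] => y ys.
have [->|y0] := eqVneq y 0; first by rewrite linear0 !normr0 mulr0.
have ny0 : 0 < `|y| by rewrite normr_gt0.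
rewrite -ler_pdivrMr// mulrC -[X in X * _]ger0_norm ?invr_ge0//.
rewrite -normrZ -linearZ/=; have [|z zs le_e] := sT (`|y|^-1 *: y).
  by rewrite normalized.
(* [T y] is orthogonal to [z], because [y] is orthogonal to [S z]; by Pythagoras, subtracting [z]
   can only increase the norm. *)
apply: le_trans le_e; rewrite -(@ler_pXn2r _ 2)// ?nnegrE//.
rewrite normDd ?lerDl ?exprn_ge0//.
by rewrite -scaleN1r innerZr TS innerZl ys ?mulr0//; exact: map_f.
Qed.

(** If [y] is orthogonal to every [T (u i)], then [T y] is orthogonal to every [u i] and lies in
    their span, so it is 0. Thus [T] vanishes on a subspace of finite codimension. *)
Lemma compactop_finite_rank T : (forall x y, inner (T x) y = inner x (T y)) ->
  finite_dim (range T) -> T \in @compactop R H.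
Proof.
move=> Tsym [n [u uT]]; apply: compactop_of_orthogonal => e e0.
exists [seq T (u i) | i <- enum 'I_n] => y yu.
suff -> : T y = 0 by rewrite normr0 mulr_ge0 ?(ltW e0).
have [|k Ty] := uT (T y); first by exists y.
apply/eqP; rewrite -normr_eq0 -sqrf_eq0 -inner_norm {2}Ty inner_sumr.
rewrite big1// => i _; rewrite innerZr Tsym yu ?mulr0//.
by apply: map_f; rewrite mem_enum.
Qed.

End Compactness.

(** * Bases of projections *)

Section Bases.
Implicit Types (x y z : H) (S T E : 'B(H)) (s : seq H).

(** Dependent choice with the finite prefixes as states, so that a new term may depend on all the
    earlier ones. *)
Lemma dependent_seq (Good : seq H -> Prop) : Good [::] ->
    (forall s, Good s -> exists x, Good (rcons s x)) ->
  exists a : nat -> H, forall n, Good (mkseq a n).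
Proof.
move=> G0 GS.
have /boolp.choice[f fP] : forall s, exists x, Good s -> Good (rcons s x).
  move=> s; have [/GS[x Gx]|nG] := pselect (Good s); first by exists x.
  by exists 0.
pose t n := iter n (fun s => rcons s (f s)) [::].
exists (fun n => f (t n)) => n.
have -> : mkseq (fun n => f (t n)) n = t n.
  by elim: n => // n IHn; rewrite mkseqS IHn.
by elim: n => // n; exact: fP.
Qed.

Lemma orthonormal_mkseq (a : nat -> H) :
    (forall n, orthonormal_upto n (nth 0 (mkseq a n))) ->
  orthonormal_seq a.
Proof.
move=> oa i j; have := oa (maxn i j).+1 i j.
rewrite !ltnS leq_maxl leq_maxr !nth_mkseq ?ltnS ?leq_maxl ?leq_maxr//.
exact.
Qed.

(** One linear condition lowers the dimension by at most one: a spanning family of the subspace,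
    together with some [a] in [A] not orthogonal to [z], spans [A]. *)
Lemma infinite_dim_orthogonal (A : set H) z :
    (forall k x y, A x -> A y -> A (k *: x + y)) -> infinite_dim A ->
  infinite_dim [set x | A x /\ inner x z = 0].
Proof.
move=> linA infA [n [e eP]]; apply: infA.
have [[a [Aa az]]|nA] := pselect (exists a, A a /\ inner a z != 0); last first.
  exists n, e => x Ax; apply: eP; split=> //.
  by have [//|xz] := eqVneq (inner x z) 0; case: nA; exists x.
exists n.+1, (fun i => if unlift ord0 i is Some j then e j else a) => x Ax.
pose k := inner x z / inner a z.
have [|c cE] := eP (x - k *: a).
  split; first by rewrite addrC -scaleNr; exact: linA.
  by rewrite innerBl innerZl divfK// subrr.
exists (fun i => if unlift ord0 i is Some j then c j else k).
rewrite big_ord_recl unlift_none -(subrK (k *: a) x) cE addrC; congr (_ + _).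
by apply: eq_bigr => i _; rewrite liftK.
Qed.

Lemma orthogonal_unit (A : set H) s :
    (forall k x y, A x -> A y -> A (k *: x + y)) -> infinite_dim A ->
  exists x, [/\ A x, `|x| = 1 & {in s, forall z, inner x z = 0}].
Proof.
elim: s A => [|z s IHs] A linA infA.
  have [[x [Ax x0]]|nA] := pselect (exists x, A x /\ x != 0); last first.
    case: infA; exists 0%N, (fun=> 0) => x Ax; exists (fun=> 0).
    rewrite big_ord0; apply: contrapT => /eqP x0; apply: nA; by exists x.
  exists (`|x|^-1 *: x); split=> //; last exact: normalized.
  have A0 : A 0 by have := linA (-1) x x Ax Ax; rewrite scaleN1r addNr.
  by rewrite -[_ *: x]addr0; exact: linA.
have [||x [[Ax xz] x1 xs]] := IHs [set x | A x /\ inner x z = 0].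
- move=> k x y [Ax xz] [Ay yz]; split; first exact: linA.
  by rewrite innerDl innerZl xz yz mulr0 addr0.
- exact: infinite_dim_orthogonal.
by exists x; split=> // y; rewrite inE => /predU1P[->|/xs].
Qed.

Lemma ker_linear T (k : R[i]) x y : T x = 0 -> T y = 0 -> T (k *: x + y) = 0.
Proof. by move=> Tx Ty; rewrite linearP/= Tx Ty scaler0 addr0. Qed.

Lemma dense_sequence : separable H -> exists d : nat -> H,
  forall x e, 0 < e -> exists n, `|x - d n| < e.
Proof.
move=> [D /countable_injP[f finj] dD].
exists (fun n => xget 0 [set x | D x /\ f x = n]) => x e e0.
have [|y [xy Dy]] := dD (ball x e) _ (ball_open _ _).
  by exists x; exact: ballxx.
exists (f y); suff -> : xget 0 [set z | D z /\ f z = f y] = y.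
  by move: xy; rewrite -ball_normE.
apply: xget_unique => // z [Dz fz]; apply: finj => //; exact: mem_set.
Qed.

Lemma bop_dense_eq0 (d : nat -> H) T :
    (forall x e, 0 < e -> exists n, `|x - d n| < e) ->
    (forall n, T (d n) = 0) ->
  T = 0.
Proof.
move=> dd Td; apply: bop_eqP => x; rewrite bop0E; apply/eqP.
rewrite -normr_eq0 eq_le normr_ge0 andbT; apply/ler_addgt0Pr => e e0.
have k0 : 0 < `|T| + 1 by rewrite ltr_wpDl.
have [n] := dd x _ (divr_gt0 e0 k0); rewrite ltr_pdivlMr// => /ltW le_e.
rewrite add0r -[T x]subr0 -(Td n) -linearB; apply: le_trans le_e.
apply: le_trans (le_opnorm _ _) _.
by rewrite mulrC ler_wpM2l// -bop_normE lerDl.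
Qed.

Lemma projection_basis E : separable H ->
    E * E = E -> (forall x y, inner (E x) y = inner x (E y)) ->
    infinite_dim (range E) ->
  exists2 a, orthonormal_seq a & E = pisom a a.
Proof.
move=> sepH EE Esym infE; have [d dP] := dense_sequence sepH.
have EEx x : E (E x) = E x by rewrite -bopME EE.
(* Each step puts the n-th vector of a dense sequence of the range of E in the
   span; if it is already there, any new unit vector of the range will do. *)
pose Good s := [/\ orthonormal_upto (size s) (nth 0 s),
  {in s, forall y, E y = y} &
  forall k, (k < size s)%N ->
    E (d k) = \sum_(0 <= i < size s) inner (E (d k)) (nth 0 s i) *: nth 0 s i].
have [||a aP] := dependent_seq (Good := Good).
- by split.
- move=> s [os Es ds]; set y := E (d (size s)).
  set r := y - \sum_(0 <= i < size s) inner y (nth 0 s i) *: nth 0 s i.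
  suff [x [xs x1 Ex rE]] : exists x, [/\ {in s, forall z, inner x z = 0},
      `|x| = 1, E x = x & r = inner y x *: x].
    exists x; split; first exact: orthonormal_rcons.
      by move=> z; rewrite mem_rcons inE => /predU1P[->|/Es].
    move=> k; rewrite size_rcons ltnS leq_eqVlt => /predU1P[->|lt_ks].
      rewrite -(size_rcons s x) (sum_nth_rcons s x (fun z => inner y z *: z)).
      by rewrite -rE addrC subrK.
    by rewrite -(size_rcons s x); apply: expand_rcons => //; exact: ds.
  have [r0|r0] := eqVneq r 0; last first.
    have [x [xs x1 rE xE]] := orthonormal_residue os erefl r0.
    exists x; split=> //; rewrite xE linearZ/=; congr (_ *: _).
    rewrite /r linearB/= EEx linear_sum/=; congr (_ - _).
    rewrite big_nat [RHS]big_nat; apply: eq_bigr => i lt_is.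
    by rewrite linearZ/= Es ?mem_nth.
  have E1 v : (E - 1) v = E v - v by [].
  have [||x [Ex x1 xs]] := orthogonal_unit (A := [set x | (E - 1) x = 0]) s.
  - by move=> k u v; exact: ker_linear.
  - move=> [n [e eP]]; apply: infE; exists n, e => _ [u _ <-]; apply: eP.
    by apply: etrans (E1 _) _; rewrite EEx subrr.
  have {}Ex : E x = x by apply: subr0_eq; exact: etrans (esym (E1 x)) Ex.
  exists x; split=> //; rewrite r0 (_ : inner y x = 0) ?scale0r//.
  rewrite (subr0_eq r0) inner_suml big_nat big1// => i lt_is.
  by rewrite innerZl [inner _ x]inner_eq0C ?mulr0// xs// mem_nth.
have oa : orthonormal_seq a.
  by apply: orthonormal_mkseq => n; have [] := aP n; rewrite size_mkseq.
have Ea n : E (a n) = a n.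
  by have [_ + _] := aP n.+1; apply; rewrite mkseqS mem_rcons mem_head.
(* [E (d n)] is a finite combination of the [a i], which [pisom a a] fixes, and the [d n] are
   dense. *)
exists a => //; have E0 : pisom a a * E - E = 0.
  apply: bop_dense_eq0 dP _ => n; rewrite bopDE bopNE bopME.
  have [_ _ /(_ n)] := aP n.+1; rewrite size_mkseq => /(_ (ltnSn n)) dE.
  rewrite [in X in X - _]dE [in X in _ - X]dE linear_sum -sumrB.
  rewrite big_nat big1// => i /andP[_ lt_in].
  by rewrite linearZ/= nth_mkseq// pisom_nth// subrr.
apply: bop_eqP => x; have /(congr1 (fun T : 'B(H) => T x)) := subr0_eq E0.
rewrite bopME => <-; apply/esym/eqP; rewrite -subr_eq0 -linearB; apply/eqP.
(* [E x - x] is orthogonal to each [a n], since [a n] lies in the range of [E]. *)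
apply: pisom_eq0 => // n.
by rewrite innerBl -[in X in X - _]Ea -Esym subrr.
Qed.

(** The second case is the default value of [adj]. It is harmless below: a self-adjoint [T] is then
    0, and a unitary [T] forces the whole space to be 0, so the adjoint identity holds anyway. *)
Lemma adj_cases T :
  (forall x y, inner (T x) y = inner x (adj T y)) \/ adj T = 0.
Proof.
have [ex|nex] :=
  pselect (exists S : 'B(H), forall x y, inner (T x) y = inner x (S y)).
  by left; exact: (xgetPex 0 ex).
by right; apply: xgetPN => S TS; apply: nex; exists S.
Qed.

Lemma selfadj_inner T : adj T = T -> forall x y, inner (T x) y = inner x (T y).
Proof.
move=> TT x y; have [|T0] := adj_cases T; first by rewrite TT.
by rewrite -TT T0 !bop0E linear0l linear0r.
Qed.

Lemma unitary_inner T : unitary T ->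
  forall x y, inner (T x) y = inner x (adj T y).
Proof.
move=> [TT _] x y; have [//|T0] := adj_cases T.
have H0 z : z = 0 by rewrite -(bop1E z) -TT T0 mul0r.
by rewrite (H0 x) linear0 !linear0l.
Qed.

End Bases.

(** * Restricted unitaries *)

Section RestrictedUnitary.
Implicit Types (x y z : H) (P Q S T U V : 'B(H)) (a b : nat -> H).

Lemma compactopZ (k : R[i]) T :
  T \in @compactop R H -> k *: T \in @compactop R H.
Proof.
move=> cT; have -> : k *: T = (k *: (1 : 'B(H)) : 'B(H)) * T by exact: bop_eqP.
exact: compactop_mull.
Qed.

(* |S y|^2 = <T S y, y>, and T S is compact. *)
Lemma compactop_adj T S : (forall x y, inner (T x) y = inner x (S y)) ->
  T \in @compactop R H -> S \in @compactop R H.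
Proof.
move=> TS cT; have cTS : T * S \in @compactop R H by exact: compactop_mulr.
have TSsym x y : inner ((T * S) x) y = inner x ((T * S) y).
  by rewrite !bopME TS [RHS]innerC TS -innerC.
apply: compactop_of_orthogonal => e e0.
have [s sP] := compactop_orthogonal cTS TSsym (exprn_gt0 2 e0).
exists s => y /sP le_e.
rewrite -(@ler_pXn2r _ 2)// ?nnegrE ?mulr_ge0 ?(ltW e0)//.
rewrite -inner_norm innerC -TS -innerC exprMn [`|y| ^+ 2]expr2 mulrA.
rewrite -[leLHS]ger0_norm.
  apply: le_trans (cauchy_schwarz _ _) _.
  by rewrite mulrC; exact: ler_wpM2r.
by rewrite innerC TS -innerC inner_norm exprn_ge0.
Qed.

Lemma unitaryM U V : unitary U -> unitary V ->
  unitary (U * V) /\ adj (U * V) = adj V * adj U.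
Proof.
move=> uU uV; have UVa : adj (U * V) = adj V * adj U.
  by apply: adj_eq => x y; rewrite !bopME !unitary_inner.
have [[UU UU'] [VV VV']] := (uU, uV).
split=> //; split; rewrite UVa.
  by rewrite mulrA -(mulrA (adj V)) UU mulr1 VV.
by rewrite mulrA -(mulrA U) VV' mulr1 UU'.
Qed.

Lemma U_resM P U V : U_res P U -> U_res P V -> U_res P (U * V).
Proof.
move=> [uU cU] [uV cV]; split; first by have [] := unitaryM uU uV.
have -> : U * V * P - P * (U * V) = U * (V * P - P * V) + (U * P - P * U) * V.
  by rewrite mulrBr mulrBl !mulrA addrA subrK.
by apply: rpredD; [exact: compactop_mull | exact: compactop_mulr].
Qed.

Lemma unitary1 : unitary (1 : 'B(H)).
Proof. by split; rewrite Defs.adj1 mul1r. Qed.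

Lemma U_res1 P : U_res P 1.
Proof. by split; [exact: unitary1 | rewrite mul1r mulr1 subrr rpred0]. Qed.

Lemma norm_unitary U x : unitary U -> `|U x| = `|x|.
Proof.
move=> uU; apply/eqP; rewrite -(@eqrXn2 _ 2)// -!inner_norm unitary_inner//.
by rewrite -bopME uU.1.
Qed.

Lemma opnormM S T : `|S * T| <= `|S| * `|T|.
Proof.
apply: opnorm_le => [|x]; first by rewrite mulr_ge0.
rewrite bopME; apply: le_trans (le_opnorm _ _) _; rewrite -mulrA.
by apply: ler_wpM2l; [exact: opnorm_ge0 | exact: le_opnorm].
Qed.

Lemma lipschitz_within (V W : normedModType R[i]) (A : set V) (f : V -> W)
    (k : R[i]) : 0 <= k ->
    (forall u v, A u -> A v -> `|f u - f v| <= k * `|u - v|) ->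
  {within A, continuous f}.
Proof.
move=> k0 fk; apply/subspace_continuousP => u Au.
apply/cvgrPdist_lt => e e0; rewrite near_withinE.
have k1 : 0 < k + 1 by rewrite ltr_wpDl.
have : nbhs u (ball u (e / (k + 1))) by apply: nbhsx_ballx; exact: divr_gt0.
apply: filterS => v; rewrite -ball_normE /= ltr_pdivlMr// => lt_e Av.
apply: le_lt_trans lt_e; apply: le_trans (fk _ _ Au Av) _.
by rewrite mulrC ler_wpM2l// lerDl.
Qed.

(** Right translation by [V] is continuous and maps the component of 1 onto a connected subset of
    [U_res P] that contains both [V] and [U * V]. *)
Lemma U_res0M P U V : U_res0 P U -> U_res0 P V -> U_res0 P (U * V).
Proof.
move=> U0 V0; have resV : U_res P V by exact: connected_component_sub V0.
apply: connected_component_trans V0 _.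
apply: (@connected_component_max _ _ [set T * V | T in U_res0 P]).
- by exists 1; [exact/connected_component_refl/U_res1 | rewrite mul1r].
- move=> _ [T /connected_component_sub resT <-]; exact: U_resM.
- apply: connected_continuous_connected; first exact: component_connected.
  apply: (lipschitz_within (k := `|V|)) => // S T _ _.
  by rewrite -mulrBl mulrC; exact: opnormM.
- by exists U.
Qed.

Lemma continuous_scale (f : R -> R) T : continuous f ->
  continuous (fun t : R => (f t)%:C *: T).
Proof.
move=> cf t; apply/cvgrPdist_lt => e e0.
have k0 : 0 < `|T| + 1 by rewrite ltr_wpDl.
have d0 := divr_gt0 e0 k0; pose d := complex.Re (e / (`|T| + 1)).
have dE : e / (`|T| + 1) = d%:C by exact: gt0_ReE d0.
have {}d0 : 0 < d by rewrite -ltcR -dE.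
have /cvgrPdist_lt/(_ _ d0) := cf t; apply: filterS => u.
rewrite -ltcR -dE -normC_real ltr_pdivlMr// => lt_e.
rewrite -scalerBl normrZ -rmorphB; apply: le_lt_trans lt_e.
by rewrite ler_wpM2l// lerDl.
Qed.

Lemma conjC_realC (r : R) : (r%:C : R[i])^*%R = r%:C.
Proof. exact: conjc_real. Qed.

(** [J] plays the role of the imaginary unit: the adjoint of [c + s J] is [c - s J], and their
    product is [c ^+ 2 + s ^+ 2]. *)
Lemma rotation_unitary (J : 'B(H)) (c s : R) :
    (forall x y, inner (J x) y = - inner x (J y)) ->
    (forall x, J (J x) = - x) ->
    c ^+ 2 + s ^+ 2 = 1 ->
  unitary (c%:C *: (1 : 'B(H)) + s%:C *: J).
Proof.
move=> Jskew JJ cs1; pose v (r : R) : 'B(H) := c%:C *: (1 : 'B(H)) + r%:C *: J.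
have vE r x : v r x = c%:C *: x + r%:C *: J x by [].
have vv r : r ^+ 2 = s ^+ 2 -> v r * v (- r) = 1.
  move=> rs; apply: bop_eqP => x.
  rewrite bopME !vE [J (_ + _)]linearD/= ![J (_ *: _)]linearZ/= JJ.
  rewrite !scalerDr !scalerA rmorphN !mulrN !scaleNr scalerN opprK.
  rewrite [r%:C * c%:C]mulrC addrA subrK -scalerDl.
  by rewrite -!rmorphM -rmorphD -!expr2 rs cs1 scale1r.
have -> : c%:C *: (1 : 'B(H)) + s%:C *: J = v s by [].
have adjv : adj (v s) = v (- s).
  apply: adj_eq => x y; rewrite !vE innerDl innerDr !innerZl !innerZr Jskew.
  by rewrite !conjC_realC rmorphN mulrN mulNr.
split; rewrite adjv; last exact: vv.
by rewrite -[in X in _ * X](opprK s) vv ?sqrrN.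
Qed.

(** The factor ['i] makes the symmetry skew with square -1, so that rotations join it to 1; the
    factor cancels in the conjugation. *)
Lemma symmetry_in_U_res0 P S : (forall x y, inner (S x) y = inner x (S y)) ->
    S * S = 1 -> S * P - P * S \in @compactop R H ->
  exists2 U, U_res0 P U & forall Q, U * Q * adj U = S * Q * S.
Proof.
move=> Ssym SS cS; have [J JE] : exists J : 'B(H), forall x, J x = 'i *: S x.
  by exists ('i *: S).
have Jskew x y : inner (J x) y = - inner x (J y).
  by rewrite !JE innerZl innerZr conjCi mulNr opprK Ssym.
have JJ x : J (J x) = - x.
  rewrite !JE [S (_ *: _)]linearZ/= scalerA -expr2 sqrCi -bopME SS bop1E.
  by rewrite scaleN1r.
have cJ : J * P - P * J \in @compactop R H.
  have -> : J * P - P * J = 'i *: (S * P - P * S); last exact: compactopZ.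
  apply: bop_eqP => x; rewrite bopZE !bopDE !bopNE !bopME !JE.
  by rewrite [P (_ *: _)]linearZ/= scalerBr.
(* u is a path in U_res P from 1 to J = i S. *)
pose u (t : R) : 'B(H) := (cos t)%:C *: (1 : 'B(H)) + (sin t)%:C *: J.
have u0 : u 0 = 1 by rewrite /u cos0 sin0 scale0r addr0 scale1r.
have upi : u (pi / 2) = J.
  by rewrite /u cos_pihalf sin_pihalf scale0r add0r scale1r.
have resu (t : R) : U_res P (u t).
  split; first exact: rotation_unitary (cos2Dsin2 t).
  have -> : u t * P - P * u t = (sin t)%:C *: (J * P - P * J).
    apply: bop_eqP => x.
    rewrite bopZE !bopDE !bopNE !bopME /u !bopDE !bopZE !bop1E.
    rewrite [P (_ + _)]linearD/= ![P (_ *: _)]linearZ/= opprD addrACA.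
    by rewrite subrr add0r scalerBr.
  exact: compactopZ.
exists J; last first.
  have adjJ : adj J = - J.
    by apply: adj_eq => x y; rewrite Jskew bopNE linearNr.
  move=> Q; rewrite adjJ; apply: bop_eqP => x.
  rewrite !bopME bopNE !JE [Q (- _)]linearN/= [Q (_ *: _)]linearZ/=.
  rewrite [S (- _)]linearN/= [S (_ *: _)]linearZ/= scalerN scalerA -expr2 sqrCi.
  by rewrite scaleN1r opprK.
rewrite -upi.
apply: (@connected_component_max _ _ [set u t | t in `[0, pi / 2]%classic]).
- by exists 0 => //=; rewrite in_itv/= lexx divr_ge0// pi_ge0.
- by move=> _ [t _ <-]; exact: resu.
- apply: connected_continuous_connected; first exact: segment_connected.
  apply: continuous_subspaceT => t; apply: cvgD.
    exact: (continuous_scale (T := 1) (@continuous_cos R)).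
  exact: (continuous_scale (T := J) (@continuous_sin R)).
- by exists (pi / 2) => //=; rewrite in_itv/= lexx divr_ge0// pi_ge0.
Qed.

(** [m] is a symmetry in the corner of the idempotent [r], completed by the identity on the
    complementary corner. *)
Lemma symmetry_square (A : pzRingType) (m r : A) :
    m * m = r -> m * r = m -> r * m = m -> r * r = r ->
  (m + (1 - r)) * (m + (1 - r)) = 1.
Proof.
move=> mm mr rm rr.
have mz : m * (1 - r) = 0 by rewrite mulrBr mulr1 mr subrr.
have zm : (1 - r) * m = 0 by rewrite mulrBl mul1r rm subrr.
have zz : (1 - r) * (1 - r) = 1 - r.
  by rewrite mulrBl mul1r mulrBr mulr1 rr subrr subr0.
rewrite mulrDl [m * _]mulrDr [(1 - r) * _]mulrDr mm mz zm zz addr0 add0r.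
by rewrite addrC subrK.
Qed.

Lemma swap_orthogonal P a b : (forall x y, inner (P x) y = inner x (P y)) ->
    orthonormal_seq a -> orthonormal_seq b -> orthogonal_seq a b ->
    P * pisom a a \in @compactop R H -> P * pisom b b \in @compactop R H ->
  exists2 U, U_res0 P U & U * pisom a a * adj U = pisom b b.
Proof.
move=> Psym oa ob oab ca cb; have oba := orthogonal_seq_sym oab.
pose m := pisom a b + pisom b a; pose r := pisom a a + pisom b b.
pose S := m + (1 - r).
have mm : m * m = r.
  by rewrite /m /r mulrDl !mulrDr !pisomM// !pisomM0// addr0 add0r addrC.
have mr : m * r = m.
  by rewrite /m /r mulrDl !mulrDr !pisomM// !pisomM0// addr0 add0r.
have rm : r * m = m.
  by rewrite /m /r mulrDl !mulrDr !pisomM// !pisomM0// addr0 add0r addrC.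
have rr : r * r = r.
  by rewrite /r mulrDl !mulrDr !pisomM// !pisomM0// addr0 add0r.
have SS : S * S = 1 by exact: symmetry_square.
have Ssym x y : inner (S x) y = inner x (S y).
  rewrite /S /m /r !bopDE !bopNE !bopDE !bop1E !innerDl !innerDr.
  rewrite innerNl innerNr !innerDl !innerDr !adj_pisom//.
  by rewrite [X in X + _]addrC.
(* [pisom c d] factors through [pisom d d] on the left and through [pisom c c] on the right;
   [pisom c c * P] is compact as the adjoint of [P * pisom c c]. *)
have cab c d : orthonormal_seq c -> orthonormal_seq d ->
    P * pisom c c \in @compactop R H -> P * pisom d d \in @compactop R H ->
    P * pisom c d \in @compactop R H /\ pisom c d * P \in @compactop R H.
  move=> oc od cc cd; split.
    by rewrite -(pisomM oc od od) mulrA compactop_mulr.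
  rewrite -(pisomM oc oc od) -mulrA compactop_mull//.
  by apply: compactop_adj cc => x y; rewrite !bopME Psym adj_pisom.
have cS : S * P - P * S \in @compactop R H.
  have -> : S * P - P * S = (m * P - P * m) - (r * P - P * r).
    rewrite /S mulrDl mulrDr mulrBl mulrBr mul1r mulr1.
    rewrite opprD addrACA; congr (_ + _).
    by rewrite !opprB addrC addrA subrK.
  have [caa1 caa2] := cab a a oa oa ca ca.
  have [cab1 cab2] := cab a b oa ob ca cb.
  have [cba1 cba2] := cab b a ob oa cb ca.
  have [cbb1 cbb2] := cab b b ob ob cb cb.
  by rewrite /m /r !mulrDl !mulrDr !rpredB// ?rpredD.
have [U U0 UE] := symmetry_in_U_res0 Ssym SS cS.
exists U => //; rewrite UE.
(* [S] restricts to [a n |-> b n] on the span of [a]; multiplying by [S] on the right then composes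
   this with [b n |-> a n]. *)
have Sa : S * pisom a a = pisom a b.
  rewrite /S /m /r mulrDl mulrBl mul1r !mulrDl !pisomM// !pisomM0//.
  by rewrite !addr0 subrr addr0.
rewrite Sa /S /m /r mulrDr mulrBr mulr1 !mulrDr !pisomM// !pisomM0//.
by rewrite !add0r !addr0 subrr addr0.
Qed.

End RestrictedUnitary.

(** * Transitivity *)

Section Transitivity.
Implicit Types (x y z : H) (P Q S T U V : 'B(H)) (a b : nat -> H).

(** The supply of vectors for the intermediate sequences. Stated apart from [C_inf], it also covers
    [P = 0], where it follows from an infinite-dimensional kernel of [Q]. *)
Definition almost_kernel P Q := forall (e : R[i]) (s : seq H), 0 < e ->
  exists x, [/\ Q x = 0, `|P x| <= e, `|x| = 1
              & {in s, forall z, inner x z = 0}].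

Lemma almost_kernel_pair P Q Q' : almost_kernel P Q -> almost_kernel P Q' ->
  exists a b, [/\ orthonormal_seq a, orthonormal_seq b, orthogonal_seq a b,
    forall n, Q (a n) = 0 /\ `|P (a n)| <= 4^-1 ^+ n
    & forall n, Q' (b n) = 0 /\ `|P (b n)| <= 4^-1 ^+ n].
Proof.
move=> kQ kQ'.
(* The two sequences are the even and the odd terms of a single one. *)
pose Good s := orthonormal_upto (size s) (nth 0 s) /\
  forall k, (k < size s)%N -> `|P (nth 0 s k)| <= 4^-1 ^+ k /\
    (if odd k then Q' else Q) (nth 0 s k) = 0.
have [||w wP] := dependent_seq (Good := Good).
- by split.
- move=> s [os sP].
  have [x [Qx Px x1 xs]] : exists x, [/\ (if odd (size s) then Q' else Q) x = 0,
      `|P x| <= 4^-1 ^+ size s, `|x| = 1 & {in s, forall z, inner x z = 0}].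
    by case: odd; [apply: kQ' | apply: kQ]; rewrite exprn_gt0// invr_gt0.
  exists x; split; first exact: orthonormal_rcons.
  move=> k; rewrite size_rcons ltnS leq_eqVlt nth_rcons.
  by move=> /predU1P[->|lt_ks]; [rewrite ltnn eqxx | rewrite lt_ks; exact: sP].
have ow : orthonormal_seq w.
  by apply: orthonormal_mkseq => n; have [] := wP n; rewrite size_mkseq.
have Pw k : `|P (w k)| <= 4^-1 ^+ k /\ (if odd k then Q' else Q) (w k) = 0.
  by have [_ /(_ k)] := wP k.+1; rewrite size_mkseq nth_mkseq//; apply.
have le4 k n : (n <= k)%N -> (4^-1 : R[i]) ^+ k <= 4^-1 ^+ n.
  move=> le_nk; apply: ler_wiXn2l => //.
  by rewrite invf_le1// ler1n.
exists (fun n => w n.*2), (fun n => w n.*2.+1); split.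
- by move=> i j; rewrite ow eqn_leq !leq_double -eqn_leq.
- by move=> i j; rewrite ow eqSS eqn_leq !leq_double -eqn_leq.
- move=> i j; rewrite ow (_ : _ == _ = false)//.
  by apply/negbTE/eqP => /(congr1 odd); rewrite /= !odd_double.
- move=> n; have := Pw n.*2; rewrite odd_double => -[le_P ->]; split=> //.
  by apply: le_trans le_P (le4 _ _ _); rewrite -addnn leq_addr.
- move=> n; have := Pw n.*2.+1; rewrite /= odd_double => -[le_P ->].
  split=> //; apply: le_trans le_P (le4 _ _ _).
  by rewrite -addnn -addnS leq_addr.
Qed.

Lemma geometric_sum_lt2 n : \sum_(0 <= i < n) (2^-1 : R[i]) ^+ i <= 2.
Proof.
suff -> : \sum_(0 <= i < n) (2^-1 : R[i]) ^+ i = 2 - 2 * 2^-1 ^+ n.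
  by rewrite gerBl mulr_ge0// exprn_ge0// invr_ge0.
elim: n => [|n IHn]; first by rewrite big_geq// expr0 mulr1 subrr.
rewrite big_nat_recr//= IHn exprS mulrA mulfV ?pnatr_eq0// mul1r.
by rewrite mulr_natl mulr2n opprD addrA subrK.
Qed.

Lemma compactop_small_basis P a : orthonormal_seq a ->
  (forall n, `|P (a n)| <= 4^-1 ^+ n) -> P * pisom a a \in @compactop R H.
Proof.
move=> oa Pa; apply: compactop_of_orthogonal => e e0.
have [N Ne] : exists N, (2^-1 : R[i]) ^+ N * 2 <= e.
  have e'0 : 0 < complex.Re e by rewrite -ltcR -gt0_ReE.
  (* [N] exceeds [2 / e], and [2 ^+ N] exceeds [N]. *)
  exists (Num.truncn (2 / complex.Re e)).+1; set N := (Num.truncn _).+1.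
  have N2 : 2 / complex.Re e < 2 ^+ N.
    have /andP[_ /lt_trans] := truncn_itv (ltW (divr_gt0 (ltr0n R 2) e'0)).
    by apply; rewrite -natrX ltr_nat ltn_expl.
  rewrite [e](gt0_ReE e0) exprVn mulrC ler_pdivrMr ?exprn_gt0//.
  move: N2; rewrite ltr_pdivrMr// -ltcR => /ltW.
  by rewrite rmorphM rmorphXn !rmorph_nat mulrC.
exists (mkseq a N) => y ya; rewrite bopME.
apply: le_cvg_norm (bop_cvg (pisom_cvg (y := y) oa oa)) _ => n.
(* The coefficients of index below [N] vanish. From [N] on, [4^-1 ^+ i] is split into two factors
   [2^-1 ^+ i], one bounded by [2^-1 ^+ N] and one kept for the summation. *)
have small i : `|inner y (a i) *: P (a i)| <= `|y| * 2^-1 ^+ N * 2^-1 ^+ i.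
  have [lt_iN|le_Ni] := ltnP i N.
    rewrite ya ?scale0r ?normr0; last by apply/map_f; rewrite mem_iota.
    by rewrite !mulr_ge0// exprn_ge0// invr_ge0.
  rewrite normrZ -mulrA; apply: ler_pM => //.
    by apply: norm_inner_unit; exact: norm_orthonormal (upto_seq oa) (ltnSn i).
  apply: le_trans (Pa i) _; rewrite -[4]/(2 * 2)%:R natrM invfM exprMn.
  rewrite ler_wpM2r ?exprn_ge0 ?invr_ge0//; apply: ler_wiXn2l => //.
  by rewrite invf_le1// ler1n.
rewrite /pisom_sum /series/= linear_sum.
under eq_bigr do rewrite linearZ/=.
apply: le_trans (ler_norm_sum _ _ _) _.
apply: le_trans (ler_sum _ (fun i _ => small i)) _.
rewrite -mulr_sumr -mulrA mulrC; apply: ler_wpM2r => //.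
apply: le_trans Ne; rewrite ler_wpM2l ?exprn_ge0 ?invr_ge0//.
exact: geometric_sum_lt2.
Qed.

Lemma U_res0_conjM P Q U V : U_res0 P U -> U_res0 P V ->
  U * V * Q * adj (U * V) = U * (V * Q * adj V) * adj U.
Proof.
move=> /connected_component_sub[uU _] /connected_component_sub[uV _].
by rewrite (unitaryM uU uV).2 !mulrA.
Qed.

Lemma U_res0_transitive P Q Q' : separable H ->
    (forall x y, inner (P x) y = inner x (P y)) ->
    is_projection Q -> is_projection Q' ->
    infinite_dim (range Q) -> infinite_dim (range Q') ->
    P * Q \in @compactop R H -> P * Q' \in @compactop R H ->
    almost_kernel P Q -> almost_kernel P Q' ->
  exists2 U, U_res0 P U & U * Q * adj U = Q'.
Proof.
move=> sepH Psym [QQ /selfadj_inner Qsym] [QQ' /selfadj_inner Qsym'].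
move=> iQ iQ' cQ cQ' kQ kQ'.
have [a oa Qa] := projection_basis sepH QQ Qsym iQ.
have [b ob Qb] := projection_basis sepH QQ' Qsym' iQ'.
have [x [y [ox oy oxy xP yP]]] := almost_kernel_pair kQ kQ'.
have cx := compactop_small_basis ox (fun n => (xP n).2).
have cy := compactop_small_basis oy (fun n => (yP n).2).
have oax : orthogonal_seq a x.
  move=> i j; rewrite -(pisom_nth i oa oa) -Qa Qsym (xP j).1.
  exact: linear0r.
have oyb : orthogonal_seq y b.
  apply: orthogonal_seq_sym => i j.
  rewrite -(pisom_nth i ob ob) -Qb Qsym' (yP j).1.
  exact: linear0r.
rewrite Qa in cQ *; rewrite Qb in cQ' *.
(* The ranges of [Q] and [Q'] need not be orthogonal, but consecutive sequences in the chain [a],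
   [x], [y], [b] are, which is what each swap requires. *)
have [U U0 UE] := swap_orthogonal Psym oa ox oax cQ cx.
have [V V0 VE] := swap_orthogonal Psym ox oy oxy cx cy.
have [W W0 WE] := swap_orthogonal Psym oy ob oyb cy cQ'.
exists (W * (V * U)); first by do 2?apply: U_res0M.
by rewrite !(U_res0_conjM (P := P))// ?UE ?VE ?WE//; exact: U_res0M.
Qed.

Lemma selfadj_compl P x y : (forall u v, inner (P u) v = inner u (P v)) ->
  inner ((1 - P) x) y = inner x ((1 - P) y).
Proof. by move=> Psym; rewrite !bopDE !bopNE innerBl innerBr Psym. Qed.

Lemma C_inf_almost_kernel P Q : is_projection P -> is_projection Q ->
    P * Q \in @compactop R H -> (1 - Q) * (1 - P) \notin @compactop R H ->
  almost_kernel P Q.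
Proof.
move=> [PP /selfadj_inner Psym] [QQ /selfadj_inner Qsym] cPQ ncD e s e0.
have PPx x : P (P x) = P x by rewrite -bopME PP.
have QQx x : Q (Q x) = Q x by rewrite -bopME QQ.
(* The vector sought is a multiple of D y, where y is orthogonal to finitely many
   vectors, |D y| is bounded below (D is not compact) and P D y = - K y is small
   (K is compact). *)
pose D := (1 - Q) * (1 - P); pose D' := (1 - P) * (1 - Q).
have D'E x y : inner (D x) y = inner x (D' y).
  by rewrite !bopME !selfadj_compl.
pose K := P * Q * (1 - P); pose K' := (1 - P) * Q * P.
have cK : K \in @compactop R H by exact: compactop_mulr.
have K'E x y : inner (K x) y = inner x (K' y).
  by rewrite !bopME Psym Qsym selfadj_compl.
have PD x : P (D x) = - K x.
  rewrite /D /K !bopME !bopDE !bopNE !bop1E.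
  set z := x - P x.
  rewrite [P (z - _)]linearB/= (_ : P z = 0) ?sub0r//.
  by rewrite linearB/= PPx subrr.
have QD x : Q (D x) = 0.
  by rewrite /D bopME bopDE bopNE bop1E [Q (_ - _)]linearB/= QQx subrr.
(* Contrapositive of [compactop_of_orthogonal]: as [D] is not compact, a single bound [d] fails on
   the orthogonal complement of every finite family. *)
have [d d0 dP] : exists2 d : R[i], 0 < d & forall t : seq H,
    exists2 y, {in t, forall z, inner y z = 0} & d * `|y| < `|D y|.
  apply: contrapT => nd; move/negP: ncD; apply.
  apply: compactop_of_orthogonal => d d0; apply: contrapT => nt.
  apply: nd; exists d => // t; apply: contrapT => ny; apply: nt.
  exists t => y yt; rewrite real_leNgt ?ger0_real ?mulr_ge0 ?(ltW d0)//.
  by apply/negP => lt_d; apply: ny; exists y.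
have ed0 : 0 < e * d by rewrite mulr_gt0.
(* The bound [e * d * |y|] on [K y] is below [e * |D y|]; orthogonality of [y] to [D' z] amounts to
   that of [D y] to [z]. *)
have [t tK] := compactop_orthogonal cK K'E ed0.
have [y yt Dy] := dP (t ++ [seq D' z | z <- s]).
have Dy0 : 0 < `|D y| by apply: le_lt_trans Dy; rewrite mulr_ge0// ltW.
have Dyn0 : D y != 0 by rewrite -normr_gt0.
exists (`|D y|^-1 *: D y); split.
- by rewrite linearZ/= QD scaler0.
- rewrite linearZ/= PD normrZ normrN normfV normr_id ler_pdivrMl//.
  apply: le_trans (tK _ _) _.
    by move=> z zt; apply: yt; rewrite mem_cat zt.
  by rewrite -mulrA [leRHS]mulrC ler_wpM2l ?(ltW e0)// ltW.
- exact: normalized.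
- move=> z zs; rewrite innerZl D'E yt ?mulr0//.
  by rewrite mem_cat map_f ?orbT.
Qed.

End Transitivity.

(** * Conjugation *)

Section Conjugation.
Implicit Types (P Q S T U V : 'B(H)).

Definition conjugate U T : 'B(H) := U * T * adj U.

Lemma conjugateE U T x : conjugate U T x = U (T (adj U x)).
Proof. by []. Qed.

Lemma conjugateM U S T : unitary U ->
  conjugate U S * conjugate U T = conjugate U (S * T).
Proof.
by move=> [UU _]; rewrite /conjugate !mulrA -(mulrA (U * S)) UU mulr1.
Qed.

Lemma conjugate1 U : unitary U -> conjugate U 1 = 1.
Proof. by move=> [_ UU]; rewrite /conjugate mulr1. Qed.

Lemma conjugateB U S T : conjugate U (S - T) = conjugate U S - conjugate U T.
Proof. by rewrite /conjugate mulrBr mulrBl. Qed.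

Lemma adjK U : unitary U -> adj (adj U) = U.
Proof.
by move=> uU; apply: adj_eq => x y; rewrite innerC -unitary_inner// -innerC.
Qed.

Lemma unitary_adj U : unitary U -> unitary (adj U).
Proof. by move=> uU; split; rewrite adjK//; [exact: uU.2 | exact: uU.1]. Qed.

Lemma conjugateK U T : unitary U -> adj U * conjugate U T * U = T.
Proof.
by move=> [UU _]; rewrite /conjugate !mulrA UU mul1r -mulrA UU mulr1.
Qed.

Lemma conjugate_compact U T : unitary U ->
  (conjugate U T \in @compactop R H) = (T \in @compactop R H).
Proof.
move=> uU; apply/idP/idP => cT; last exact/compactop_mulr/compactop_mull.
by rewrite -(conjugateK T uU); exact/compactop_mulr/compactop_mull.
Qed.

Lemma conjugate_projection U Q : unitary U -> is_projection Q ->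
  is_projection (conjugate U Q).
Proof.
move=> uU [QQ /selfadj_inner Qsym]; split; first by rewrite conjugateM// QQ.
apply: adj_eq => x y; rewrite !conjugateE (unitary_inner uU) Qsym.
by rewrite (unitary_inner (unitary_adj uU)) adjK.
Qed.

(** A finite family spanning [B] is carried back by the left inverse [S] to one spanning [A]. *)
Lemma infinite_dim_transport (A B : set H) S T :
    (forall x, A x -> B (T x)) -> (forall x, A x -> S (T x) = x) ->
  infinite_dim A -> infinite_dim B.
Proof.
move=> AB ST infA [n [e eP]]; apply: infA; exists n, (fun i => S (e i)).
move=> x Ax; have [c TxE] := eP _ (AB _ Ax); exists c.
rewrite -[LHS](ST _ Ax) TxE linear_sum.
by apply: eq_bigr => i _; rewrite linearZ.
Qed.

Lemma P_inf_conjugate U P : unitary U -> P_inf P -> P_inf (conjugate U P).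
Proof.
move=> uU [pP rP kP]; have UUx x : adj U (U x) = x by rewrite -bopME uU.1.
split; first exact: conjugate_projection.
- apply: infinite_dim_transport rP => [_ [x _ <-]|x _]; last exact: UUx.
  by exists (U x) => //; rewrite conjugateE UUx.
- apply: infinite_dim_transport kP => [x /= Px|x _]; last exact: UUx.
  by apply: etrans (conjugateE _ _ _) _; rewrite UUx Px linear0.
Qed.

Lemma C_inf_conjugate U P Q : unitary U -> C_inf P Q ->
  C_inf (conjugate U P) (conjugate U Q).
Proof.
move=> uU [pQ cPQ n1 n0].
have complE T : 1 - conjugate U T = conjugate U (1 - T).
  by rewrite conjugateB conjugate1.
split; first exact: conjugate_projection.
- by rewrite conjugateM// conjugate_compact.
- rewrite !complE !conjugateM// => /calkin_piP.
  by rewrite -conjugateB conjugate_compact// => /calkin_piP.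
- rewrite !complE !conjugateM// -calkin_pi0 => /calkin_piP.
  rewrite subr0 conjugate_compact// => cT; apply: n0.
  by rewrite -calkin_pi0; apply/calkin_piP; rewrite subr0.
Qed.

(** The conditions that involve [P] depend only on its class modulo the compact operators. *)
Lemma C_inf_mod_compact P P' Q : P - P' \in @compactop R H ->
  C_inf P Q -> C_inf P' Q.
Proof.
move=> cP [pQ cPQ n1 n0].
have cc : (1 - P) - (1 - P') \in @compactop R H.
  by rewrite opprB addrC addrA subrK -opprB rpredN.
have eq1 : calkin_pi (1 - P) = calkin_pi (1 - P') by exact/calkin_piP.
have eq2 : calkin_pi ((1 - P) * (1 - Q) * (1 - P)) =
           calkin_pi ((1 - P') * (1 - Q) * (1 - P')).
  have split3 (p p' q : 'B(H)) :
      p * q * p - p' * q * p' = (p - p') * (q * p) + p' * q * (p - p').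
    by rewrite mulrBl mulrBr !mulrA addrA subrK.
  apply/calkin_piP; rewrite split3.
  by apply: rpredD; [exact: compactop_mulr | exact: compactop_mull].
split=> //; last by rewrite -eq2.
  have -> : P' * Q = P * Q - (P - P') * Q by rewrite mulrBl opprB addrC subrK.
  by rewrite rpredB// compactop_mulr.
by rewrite -eq2 -eq1.
Qed.

(** Conjugating both projections preserves the relation, and [conjugate U P] differs from [P] by a
    compact operator. *)
Lemma C_inf_U_res P Q U : U_res P U -> C_inf P Q -> C_inf P (conjugate U Q).
Proof.
move=> [uU cU] CQ; apply: C_inf_mod_compact (C_inf_conjugate uU CQ).
have -> : conjugate U P - P = (U * P - P * U) * adj U.
  by rewrite mulrBl -(mulrA P) uU.2 mulr1.
exact: compactop_mulr.
Qed.

(** * Continuity of conjugation, transitivity and connectedness *)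

Lemma norm_unitary_le1 U : unitary U -> `|U| <= 1.
Proof. by move=> uU; apply: opnorm_le => // x; rewrite mul1r norm_unitary. Qed.

(** The difference telescopes, and [adj U - adj V] is written as [adj U * (V - U) * adj V], so that
    both terms are controlled by [U - V]. *)
Lemma conjugate_lipschitz U V Q : unitary U -> unitary V ->
  `|conjugate U Q - conjugate V Q| <= (`|Q| + `|Q|) * `|U - V|.
Proof.
move=> uU uV; have [uU' uV'] := (unitary_adj uU, unitary_adj uV).
have le1 S T : unitary T -> `|S * T| <= `|S|.
  move=> /norm_unitary_le1 T1; apply: le_trans (opnormM _ _) _.
  by rewrite ler_piMr.
have le1l S T : unitary T -> `|T * S| <= `|S|.
  move=> /norm_unitary_le1 T1; apply: le_trans (opnormM _ _) _.
  by rewrite ler_piMl.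
have -> : conjugate U Q - conjugate V Q =
    (U - V) * Q * adj U + V * (Q * (adj U * (V - U) * adj V)).
  have -> : adj U * (V - U) * adj V = adj U - adj V.
    by rewrite mulrBr mulrBl uU.1 mul1r -mulrA uV.2 mulr1.
  by rewrite /conjugate !mulrBl !mulrBr !mulrA addrA subrK.
apply: le_trans (ler_normD _ _) _; rewrite [leRHS]mulrDl; apply: lerD.
  by apply: le_trans (le1 _ _ uU') _; rewrite mulrC; exact: opnormM.
apply: le_trans (le1l _ _ uV) _; apply: le_trans (opnormM _ _) _.
rewrite ler_wpM2l// -normrN -mulNr -mulrN opprB.
by apply: le_trans (le1 _ _ uV') _; exact: le1l.
Qed.

Lemma conjugate_orbit_connected P Q :
  connected [set conjugate U Q | U in U_res0 P].
Proof.
apply: connected_continuous_connected; first exact: component_connected.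
apply: (lipschitz_within (k := `|Q| + `|Q|));
  first by rewrite addr_ge0.
move=> U V /connected_component_sub[uU _] /connected_component_sub[uV _].
exact: conjugate_lipschitz.
Qed.

Lemma C_inf_transitive P Q Q' : separable H -> is_projection P ->
    C_inf P Q -> C_inf P Q' ->
  exists2 U, U_res0 P U & conjugate U Q = Q'.
Proof.
move=> sepH pP; have [PP /selfadj_inner Psym] := pP.
(* A [T] of finite rank is compact, and the compression of [1 - T] then has the class of [1 - P],
   which the first inequality excludes. *)
have range_inf T : C_inf P T -> infinite_dim (range T).
  move=> [[TT /selfadj_inner Tsym] _ n1 _] finT; apply: n1; apply/calkin_piP.
  have compr (p : 'B(H)) : p * p = p -> p * (1 - T) * p - p = - (p * T * p).
    by move=> pp; rewrite mulrBr mulr1 mulrBl pp addrC addrA addNr sub0r.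
  rewrite compr; last by rewrite mulrBl mul1r mulrBr mulr1 PP subrr subr0.
  rewrite rpredN; apply/compactop_mulr/compactop_mull.
  exact: compactop_finite_rank.
(* If [(1 - T) * (1 - P)] were compact, the compression of [1 - T] would have class 0, which the
   second inequality excludes. *)
have almost T : C_inf P T -> almost_kernel P T.
  move=> [pT cPT _ n0]; apply: C_inf_almost_kernel => //.
  apply/negP => cD; apply: n0; rewrite -calkin_pi0; apply/calkin_piP.
  by rewrite subr0 -mulrA compactop_mull.
move=> CQ CQ'; have [[pQ cQ _ _] [pQ' cQ' _ _]] := (CQ, CQ').
by apply: U_res0_transitive => //; [exact: range_inf | exact: range_inf |
  exact: almost | exact: almost].
Qed.

(** Every operator commutes with 0, so [U_res 0] is the whole unitary group and the compactness
    conditions are trivial. *)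
Lemma P_inf_transitive P P' : separable H -> P_inf P -> P_inf P' ->
  exists2 U, U_res0 0 U & conjugate U P = P'.
Proof.
move=> sepH [pP rP kP] [pP' rP' kP'].
have almost T : infinite_dim [set x | T x = 0] -> almost_kernel 0 T.
  move=> infT e s e0.
  have [||x [Tx x1 xs]] := orthogonal_unit (A := [set x | T x = 0]) s.
  - by move=> k x y; exact: ker_linear.
  - by [].
  by exists x; split=> //; rewrite bop0E normr0 ltW.
apply: U_res0_transitive => //.
- by move=> x y; rewrite !bop0E linear0l linear0r.
- by rewrite mul0r rpred0.
- by rewrite mul0r rpred0.
- exact: almost.
- exact: almost.
Qed.

(** If it is not empty, [C_inf P] is one orbit, the continuous image of the connected set
    [U_res0 P]. *)
Lemma C_inf_connected P : separable H -> is_projection P -> connected (C_inf P).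
Proof.
move=> sepH pP; have [[Q CQ]|nC] := pselect (exists Q, C_inf P Q); last first.
  rewrite (_ : C_inf P = set0); first exact: connected0.
  by rewrite -subset0 => Q CQ; apply: nC; exists Q.
rewrite (_ : C_inf P = [set conjugate U Q | U in U_res0 P]).
  exact: conjugate_orbit_connected.
apply/seteqP; split=> [Q' CQ'|_ [U /connected_component_sub resU <-]].
  by have [U U0 <-] := C_inf_transitive sepH pP CQ CQ'; exists U.
exact: C_inf_U_res.
Qed.

Lemma cvg_within_pair (X Y Z : topologicalType) (A : set X) (f : X -> Y)
    (g : X -> Z) :
  {within A, continuous f} -> {within A, continuous g} ->
  {within A, continuous (fun x => (f x, g x))}.
Proof.
move=> /subspace_continuousP cf /subspace_continuousP cg.
by apply/subspace_continuousP => x Ax; apply: cvg_pair; [exact: cf | exact: cg].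
Qed.

(** Every pair is shown to lie in the component of a fixed one; conjugating both entries by the same
    unitary does not leave [C_inf_pairs H]. *)
Lemma C_inf_pairs_connected : separable H -> connected (C_inf_pairs H).
Proof.
move=> sepH.
have [[[P Q] C]|nC] := pselect (exists PQ, C_inf_pairs H PQ); last first.
  rewrite (_ : C_inf_pairs H = set0); first exact: connected0.
  by rewrite -subset0 => PQ C; apply: nC; exists PQ.
rewrite (_ : C_inf_pairs H = connected_component (C_inf_pairs H) (P, Q)).
  exact: component_connected.
apply/seteqP; split=> [[P' Q'] C'|]; last exact: connected_component_sub.
have [[/= iP CQ] [/= iP' CQ']] := (C, C').
(* Conjugation moves P to P'; then move the second component within
   C_inf P'. *)
have [U U0 UP] := P_inf_transitive sepH iP iP'.
have [uU _] := connected_component_sub U0.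
pose f V := (conjugate V P, conjugate V Q).
apply: (@connected_component_trans _ _ (f U)).
  apply: (@connected_component_max _ _ (f @` U_res0 0)).
  - exists 1; first exact/connected_component_refl/U_res1.
    by rewrite /f /conjugate Defs.adj1 !mul1r !mulr1.
  - move=> _ [V /connected_component_sub[uV _] <-]; split.
      exact: P_inf_conjugate.
    exact: C_inf_conjugate.
  - apply: connected_continuous_connected; first exact: component_connected.
    apply: cvg_within_pair.
      apply: (lipschitz_within (k := `|P| + `|P|));
        first by rewrite addr_ge0.
      move=> S T /connected_component_sub[uS _] /connected_component_sub[uT _].
      exact: conjugate_lipschitz.
    apply: (lipschitz_within (k := `|Q| + `|Q|));
      first by rewrite addr_ge0.
    move=> S T /connected_component_sub[uS _] /connected_component_sub[uT _].
    exact: conjugate_lipschitz.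
  - by exists U.
apply: (@connected_component_max _ _ (pair P' @` C_inf P')).
- exists (conjugate U Q); last by rewrite /f UP.
  by rewrite -UP; exact: C_inf_conjugate.
- by move=> _ [T CT <-].
- apply: connected_continuous_connected.
    by have [pP' _ _] := iP'; exact: C_inf_connected.
  apply: cvg_within_pair; apply: continuous_subspaceT => T.
    exact: cst_continuous.
  exact: cvg_id.
- by exists Q'.
Qed.

End Conjugation.

End HilbertSpace.

Theorem theorem7p6 (R : realType) (H : hilbertType R)
    (H_separable : separable H)
    (H_infinite : infinite_dim [set: H])
    (P0 : 'B(H)) (P0_inf : P_inf P0) :
  ((forall U Q : 'B(H), U_res0 P0 U -> C_inf P0 Q ->
      C_inf P0 (U * Q * adj U)) /\
   (forall Q Q' : 'B(H), C_inf P0 Q -> C_inf P0 Q' ->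
      exists2 U : 'B(H), U_res0 P0 U & U * Q * adj U = Q') /\
   connected (C_inf P0)) /\
  connected (C_inf_pairs H).
Proof.
have [pP0 _ _] := P0_inf.
split; last exact: C_inf_pairs_connected.
split; first by move=> U Q /connected_component_sub; exact: C_inf_U_res.
split; last exact: C_inf_connected.
by move=> Q Q'; exact: C_inf_transitive.
Qed.
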